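(* Suppose a set of radial sequences $\{r_{q,d}\in(0,\infty): q\in(0,\infty),\ d\in\mathbb{N}\}$ satisfies $$r_d:=\inf_{q\in(0,\infty)} r_{q,d}/r^*_{q,d}\to\infty\quad(d\to\infty).$$ Let $(p_d)$ be a non-decreasing and diverging sequence of natural numbers satisfying $$p_d\,\Phi(-r_d)\to0\quad\text{and}\quad\frac{p_d}{\sqrt{d}}\left(3/2\right)^{3p_d/2}\to0.$$ Then, setting $\kappa_{j,d}:=\left[r_d\sqrt{d\sigma_j^2}+d\mu_j\right]^{1/j}$, the sequence of tests $$\psi_d^*(\cdot):=\mathbf{1}\Big\{\max_{j=1,\dots,p_d}\kappa_{j,d}^{-1}\|\cdot\|_j\ge1\Big\}$$ is, for every $p\in(0,\infty)$, minimax rate consistent in the sequence of testing problems $H_{0,d}:\boldsymbol{\theta}_d=\boldsymbol{0}_d$ vs. $H_{1,d}:\boldsymbol{\theta}_d\in\mathbb{V}_{p,d}$, where $\mathbb{V}_{p,d}:=\bigcup_{q\in(0,p]}\mathbb{V}^d_q(r_{q,d})$; that is, $$\mathbb{E}\,\psi_d^*(\boldsymbol{\varepsilon}_d)+1-\inf_{\boldsymbol{\theta}_d\in\mathbb{V}_{p,d}}\mathbb{E}\,\psi_d^*(\boldsymbol{\theta}_d+\boldsymbol{\varepsilon}_d)\to0\quad\text{for every }p\in(0,\infty).$$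
   Context: Let $\varepsilon_1,\varepsilon_2,\dots$ be i.i.d. standard normal random variables and $\boldsymbol{\varepsilon}_d = (\varepsilon_1,\dots,\varepsilon_d)$. $\Phi$ is the standard normal cdf. For $p\in(0,\infty)$, $\mu_p:=\mathbb{E}(|\varepsilon_1|^p)$ and $\sigma_p^2:=\mathrm{Var}(|\varepsilon_1|^p)$. For $\boldsymbol{x}\in\mathbb{R}^d$ and $q\in(0,\infty)$, $\|\boldsymbol{x}\|_q:=(\sum_{i=1}^d|x_i|^q)^{1/q}$ (also for $q<1$). For $q\in(0,\infty)$ and $r\in(0,\infty)$, $\mathbb{V}^d_q(r):=\{\boldsymbol{\theta}_d\in\mathbb{R}^d:\|\boldsymbol{\theta}_d\|_q\ge r\}$. The critical radii are $r^*_{q,d}:=d^{\frac{4-q}{4q}}$ if $q\in(0,2]$ and $r^*_{q,d}:=d^{\frac{1}{2q}}$ if $q\in(2,\infty)$. *)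

(* Defs.v *)
From HB Require Import structures.
From mathcomp Require Import all_boot all_order all_algebra.
From mathcomp Require Import all_classical all_reals all_analysis.
Set Implicit Arguments.
Unset Strict Implicit.
Unset Printing Implicit Defensive.
Import Order.TTheory GRing.Theory Num.Theory.
Import numFieldNormedType.Exports.
Local Open Scope classical_set_scope.
Local Open Scope ring_scope.

Definition mutually_independent (disp : measure_display)
    (T : measurableType disp) (R : realType) (P : probability T R)
    (X : nat -> {RV P >-> R}) : Prop :=
  forall (s : seq nat) (A : nat -> set R), uniq s ->
    (forall i, measurable (A i)) ->
    P (\bigcap_(i in [set` s]) (X i @^-1` A i)) =
      (\prod_(i <- s) P (X i @^-1` A i))%E.

(* [eps i] stands for the paper's $\varepsilon_{i+1}$. *)
Definition iid_std_normal (disp : measure_display)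
    (T : measurableType disp) (R : realType) (P : probability T R)
    (eps : nat -> {RV P >-> R}) : Prop :=
  mutually_independent eps /\
  forall (i : nat) (A : set R), measurable A ->
    distribution P (eps i) A = normal_prob 0 1 A.

Definition std_normal_cdf (R : realType) (x : R) : R :=
  fine (normal_prob (0 : R) 1 `]-oo, x]).

Definition noise (disp : measure_display) (T : measurableType disp)
    (R : realType) (P : probability T R) (eps : nat -> {RV P >-> R})
    (d : nat) (w : T) : 'rV[R]_d :=
  \row_(i < d) eps i w.

Definition abs_moment (disp : measure_display) (T : measurableType disp)
    (R : realType) (P : probability T R) (X : {RV P >-> R}) (p : R) : R :=
  fine ('E_P[fun w => (`|X w| `^ p)%R])%E.

Definition abs_variance (disp : measure_display) (T : measurableType disp)
    (R : realType) (P : probability T R) (X : {RV P >-> R}) (p : R) : R :=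
  fine ('V_P[fun w => (`|X w| `^ p)%R])%E.

(* Only a quasi-norm when [q < 1]. *)
Definition lqnorm (R : realType) (d : nat) (q : R) (x : 'rV[R]_d) : R :=
  (\sum_(i < d) `|x ord0 i| `^ q) `^ q^-1.

Definition crit_radius (R : realType) (q : R) (d : nat) : R :=
  if q <= 2 then d%:R `^ ((4 - q) / (4 * q)) else d%:R `^ (2 * q)^-1.

Definition lq_alternative (R : realType) (d : nat) (q rho : R) :
    set 'rV[R]_d :=
  [set theta | rho <= lqnorm q theta].

Definition union_alternative (R : realType) (r : R -> nat -> R) (p : R)
    (d : nat) : set 'rV[R]_d :=
  \bigcup_(q in `]0, p]) lq_alternative q (r q d).

(* The set is nonempty and, for positive radii, bounded below by 0, so [inf]
   is the genuine infimum. *)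
Definition rel_radius (R : realType) (r : R -> nat -> R) (d : nat) : R :=
  inf [set r q d / crit_radius q d | q in `]0, +oo[].

Definition kappa (disp : measure_display) (T : measurableType disp)
    (R : realType) (P : probability T R) (eps : nat -> {RV P >-> R})
    (r : R -> nat -> R) (j d : nat) : R :=
  (rel_radius r d * Num.sqrt (d%:R * abs_variance (eps 0%N) j%:R)
     + d%:R * abs_moment (eps 0%N) j%:R) `^ j%:R^-1.

(* The terms of the maximum are nonnegative, so starting it at 0 is harmless. *)
Definition max_test (disp : measure_display) (T : measurableType disp)
    (R : realType) (P : probability T R) (eps : nat -> {RV P >-> R})
    (r : R -> nat -> R) (pd : nat -> nat) (d : nat) : 'rV[R]_d -> R :=
  \1_[set x : 'rV[R]_d |
       1 <= \big[Num.max/0]_(1 <= j < (pd d).+1)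
              ((kappa eps r j d)^-1 * lqnorm j%:R x)].

(* The sum of the size of [psi d] under [theta = 0] and its maximal type II
   error over [V d] tends to 0. *)
Definition minimax_rate_consistent (disp : measure_display)
    (T : measurableType disp) (R : realType) (P : probability T R)
    (eps : nat -> {RV P >-> R}) (psi : forall d : nat, 'rV[R]_d -> R)
    (V : forall d : nat, set 'rV[R]_d) : Prop :=
  ('E_P[fun w => psi d (noise eps d w)] + 1
     - ereal_inf [set 'E_P[fun w => psi d (theta + noise eps d w)%R]
                 | theta in V d])%E @[d --> \oo] --> 0%E.

(* Main.v *)
(* The type I error is a union bound over j. Each normalised power sum of |eps_i|^j is
   compared with a Gaussian by Lindeberg's replacement argument: for a C^2 cutoff f, one
   summand at a time is replaced by a Gaussian of the same variance, and the Gaussian part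
   is absorbed by the heat semigroup, which preserves the Taylor bounds of f. At level a this
   costs a constant times a^3 (3/2)^(3j/2) / sqrt d, because the third absolute moment of
   |eps|^j is at most a constant times (3/2)^(3j/2) standard deviations cubed; the sum over
   j <= p_d is geometric.

   For the type II error a single even exponent 2m >= p suffices. Every alternative satisfies
   sum_i (th_i^2 + th_i^(2m)) >= r_d^2 sqrt d, this energy is a lower bound for the shift of
   the mean of sum_i (th_i + eps_i)^(2m), and Chebyshev's inequality concludes. *)
Require Import Defs.
From HB Require Import structures.
From mathcomp Require Import all_boot all_order all_algebra.
From mathcomp Require Import all_classical all_reals all_analysis.
From mathcomp Require Import measurable_realfun zify ring lra.
Set Implicit Arguments.
Unset Strict Implicit.
Import Order.TTheory GRing.Theory Num.Theory.
Import numFieldNormedType.Exports.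
Local Open Scope classical_set_scope.
Local Open Scope ring_scope.

(** * Gaussian integrals and the heat semigroup *)

(** Since the exponents [j] go up to [p_d], no limit theorem for fixed [j] helps: every tail bound
    has to be finite-sample and explicit in [j]. The hypothesis on [p_d] controls exactly
    [Phi(-r_d)], so the smoothing may lose only a constant factor in that tail. A normal tail at
    level [a] changes by a bounded factor over a distance of order [1/a], which fixes the width
    [3/a] of the cutoff and makes its third derivative of order [a^3]. As [r_d] may be far larger
    than any power of [p_d], this cost is tamed by lowering the level to at most [p_d^(1/3)]: then
    [a^3 <= p_d], and the resulting error is the expression in the rate condition. The price is the
    extra term [p_d Phi(-p_d^(1/3))], which vanishes because [p_d] diverges. For the alternatives
    the obstacle is a variance with powers [|th_i|^(4m-2)], which must be small against the squared
    energy. Splitting coordinates at a level [L] that grows slowly with [r_d] achieves this. The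
    exponent [2m] depends on [p] only, so all variance constants are fixed while [d] grows. *)

Section lebesgue_affine.
Context {R : realType}.
Local Notation mu := (@lebesgue_measure R).
Local Open Scope ereal_scope.

Definition affine (m s : R) (x : measurableTypeR R) : measurableTypeR R :=
  (m + s * x)%R.

Lemma measurable_affine m s : measurable_fun setT (affine m s).
Proof. by apply: measurable_funD => //; exact: measurable_funM. Qed.

HB.instance Definition _ m s :=
  isMeasurableFun.Build _ _ _ _ (affine m s) (measurable_affine m s).

(** The pushforward of Lebesgue measure along [affine m s], scaled by [s], gives every interval []a,
    b]] its length, so it is Lebesgue measure by uniqueness. *)
Lemma ge0_integral_lebesgue_affine (m s : R) (f : R -> \bar R) :
  (0 < s)%R -> measurable_fun setT f -> (forall x, 0 <= f x) ->
  \int[mu]_x f x = s%:E * \int[mu]_x f (m + s * x)%R.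
Proof.
move=> s0 mf f0.
rewrite -(@ge0_integral_pushforward _ _ _ _ _ (affine m s) _ mu setT f)//.
rewrite -(@ge0_integral_mscale _ _ _ (pushforward mu (affine m s)) setT _
  (NngNum (ltW s0)))//.
apply: eq_measure_integral => A mA _.
apply: (@lebesgue_measure_unique _ (mscale (NngNum (ltW s0))
  (pushforward mu (affine m s)))) => // _ [[a b] _ <-].
transitivity (s%:E * mu (affine m s @^-1` `]a, b])); last by [].
rewrite lebesgue_measure_itv/=.
have -> : affine m s @^-1` `]a, b] = `]((a - m) / s)%R, ((b - m) / s)%R]%classic.
  apply/seteqP; split => x /=; rewrite !in_itv/= /affine ltr_pdivrMr//
    ler_pdivlMr// ltrBlDl lerBrDl (mulrC x); exact: id.
rewrite lebesgue_measure_itv/= !lte_fin ltr_pM2r ?invr_gt0// ltrD2r.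
case: ifP => [ab|]; last by rewrite mule0.
by rewrite -!EFinB -EFinM -mulrBl mulrC divfK ?gt_eqF//; congr EFin; ring.
Qed.

Lemma ge0_integral_lebesgueN (f : R -> \bar R) :
  measurable_fun setT f -> (forall x, 0 <= f x) ->
  \int[mu]_x f x = \int[mu]_x f (- x)%R.
Proof.
move=> mf f0.
transitivity (\int[pushforward mu (-%R : _ -> measurableTypeR R)]_x f x);
  last by rewrite ge0_integral_pushforward.
by apply: eq_measure_integral => A mA _; exact/esym/lebesgue_measureN.
Qed.

End lebesgue_affine.

Section integral_density.
Context {d} {T : measurableType d} {R : realType}.
Local Open Scope ereal_scope.
Import HBNNSimple.

(* Monotone class step from sets to nonnegative functions. *)
Lemma ge0_integral_density (mu nu : {measure set T -> \bar R})
    (p : T -> R) (f : T -> \bar R) :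
  measurable_fun setT p -> (forall x, 0 <= p x)%R ->
  (forall A, measurable A -> nu A = \int[mu]_(x in A) (p x)%:E) ->
  measurable_fun setT f -> (forall x, 0 <= f x) ->
  \int[nu]_x f x = \int[mu]_x (f x * (p x)%:E).
Proof.
move=> mp p0 nuE mf f0.
have mEp : measurable_fun setT (EFin \o p) by exact/measurable_EFinP.
pose f_ := nnsfun_approx measurableT mf.
have fcvg x : EFin \o f_^~ x @ \oo --> f x.
  by apply: cvg_nnsfun_approx.
have ndf x : nondecreasing_seq (EFin \o f_^~ x).
  by move=> m n mn; rewrite lee_fin; exact/lefP/nd_nnsfun_approx.
transitivity (limn (fun n => \int[nu]_x (f_ n x)%:E)).
  rewrite -monotone_convergence//.
  - by apply: eq_integral => y _; apply/esym/cvg_lim => //; exact: fcvg.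
  - by move=> n; exact/measurable_EFinP/measurable_funP.
  - by move=> n y _; rewrite lee_fin.
  - by move=> y _; exact: ndf.
rewrite [X in limn X](_ : _ = (fun n => \int[mu]_x ((f_ n x)%:E * (p x)%:E))).
  rewrite -monotone_convergence//.
  - apply: eq_integral => y _; apply/cvg_lim => //.
    exact: (cvgeZr _ (fcvg y)).
  - move=> n; apply: emeasurable_funM => //.
    exact/measurable_EFinP/measurable_funP.
  - by move=> n y _; rewrite mule_ge0// lee_fin.
  - by move=> y _ m n mn; rewrite lee_wpmul2r ?lee_fin ?p0//; exact: ndf.
apply/funext => n.
(* For a simple function both sides are finite sums over its values, and [nuE] settles each level
   set. *)
rewrite integralT_nnsfun sintegralE.
under [RHS]eq_integral.
  move=> x _; rewrite fimfunE -fsumEFin// ge0_mule_fsuml; last first.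
    by move=> r; rewrite nnfun_muleindic_ge0.
  over.
rewrite ge0_integral_fsum//; last 2 first.
- move=> r; apply: emeasurable_funM => //.
  exact/measurable_EFinP/measurable_funM.
- by move=> r x _; rewrite mule_ge0// ?nnfun_muleindic_ge0 ?lee_fin.
apply: eq_fsbigr => r /set_mem[y _ <-].
rewrite nuE//= integral_mkcond -ge0_integralZl//; last 3 first.
- by apply/(measurable_restrictT _ _).1 => //; exact: measurable_funS mEp.
- by move=> x _; rewrite erestrict_ge0// => z _; rewrite lee_fin.
- by rewrite lee_fin.
apply: eq_integral => x _; rewrite patchE indicE; case: ifPn => _.
  by rewrite mulr1.
by rewrite mulr0 mul0e mule0.
Qed.
End integral_density.

Section gauss.
Context {R : realType}.
Local Notation mu := (@lebesgue_measure R).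
Local Notation gamma := (normal_prob (0 : R) 1).
Local Open Scope ereal_scope.

Lemma ge0_integral_normal_prob (m s : R) (f : R -> \bar R) :
  measurable_fun setT f -> (forall x, 0 <= f x) ->
  \int[normal_prob m s]_x f x = \int[mu]_x (f x * (normal_pdf m s x)%:E).
Proof.
move=> mf f0; apply: (@ge0_integral_density _ _ _ mu (normal_prob m s)) => //.
- exact: measurable_normal_pdf.
- by move=> x; exact: normal_pdf_ge0.
Qed.

Lemma normal_pdf_affine (m s x : R) : (0 < s)%R ->
  (s * normal_pdf m s (m + s * x))%R = normal_pdf 0 1 x.
Proof.
move=> s0; rewrite !normal_pdfE ?gt_eqF ?oner_eq0//.
rewrite /normal_peak /normal_fun.
have sn : s != 0%R by rewrite gt_eqF.
have -> : (- (m + s * x - m) ^+ 2 / (s ^+ 2 *+ 2) = - (x - 0) ^+ 2 / (1 ^+ 2 *+ 2))%R.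
  by field.
rewrite mulrA; congr (_ * _)%R.
rewrite -mulrnAr sqrtrM ?sqr_ge0// sqrtr_sqr gtr0_norm// invfM mulrA divff// mul1r.
by rewrite expr1n mul1r.
Qed.

Lemma ge0_integral_normal_prob_affine (m s : R) (f : R -> \bar R) :
  (0 < s)%R -> measurable_fun setT f -> (forall x, 0 <= f x) ->
  \int[normal_prob m s]_x f x = \int[gamma]_x f (m + s * x)%R.
Proof.
move=> s0 mf f0.
have mfa : measurable_fun setT (fun x => f (m + s * x)%R).
  exact: (measurableT_comp mf (measurable_affine m s)).
rewrite (ge0_integral_normal_prob _ _ mf f0).
rewrite (ge0_integral_normal_prob _ _ mfa (fun x => f0 _)).
rewrite (ge0_integral_lebesgue_affine m s0); last 2 first.
- apply: emeasurable_funM => //; apply/measurable_EFinP.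
  exact: measurable_normal_pdf.
- by move=> x; rewrite mule_ge0// lee_fin normal_pdf_ge0.
rewrite -ge0_integralZl; last 4 first.
- exact: measurableT.
- apply: emeasurable_funM; first exact: mfa.
  apply/measurable_EFinP; apply: measurableT_comp.
    exact: measurable_normal_pdf.
  exact: (measurable_affine m s).
- by move=> x _; rewrite mule_ge0// lee_fin normal_pdf_ge0.
- by rewrite lee_fin ltW.
by apply: eq_integral => x _; rewrite muleCA -EFinM normal_pdf_affine.
Qed.

Lemma normal_pdfN (x : R) : normal_pdf 0 1 (- x) = normal_pdf 0 1 x :> R.
Proof.
by rewrite !normal_pdfE ?oner_eq0// /normal_fun !subr0 sqrrN.
Qed.

Lemma ge0_integral_gaussN (f : R -> \bar R) :
  measurable_fun setT f -> (forall x, 0 <= f x) ->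
  \int[gamma]_x f (- x)%R = \int[gamma]_x f x.
Proof.
move=> mf f0.
have mfN : measurable_fun setT (fun x : R => f (- x)%R).
  by apply: (measurableT_comp mf); exact: measurable_funN.
rewrite (ge0_integral_normal_prob _ _ mf f0).
rewrite (ge0_integral_normal_prob _ _ mfN (fun x => f0 _)).
rewrite [RHS]ge0_integral_lebesgueN; last 2 first.
- apply: emeasurable_funM => //; apply/measurable_EFinP.
  exact: measurable_normal_pdf.
- by move=> x; rewrite mule_ge0// lee_fin normal_pdf_ge0.
by apply: eq_integral => x _; rewrite normal_pdfN.
Qed.

Lemma normal_pdf_shift (m s x : R) : s != 0%R ->
  normal_pdf m s x = normal_pdf 0 s (x - m).
Proof. by move=> s0; rewrite !normal_pdfE// /normal_fun subr0. Qed.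

(* Completing the square. *)
Lemma normal_pdf_mul (s t x y z : R) : (0 < s)%R -> (0 < t)%R ->
  let u := Num.sqrt (s ^+ 2 + t ^+ 2) in
  (normal_pdf x s y * normal_pdf y t z =
   normal_pdf x u z *
   normal_pdf ((x * t ^+ 2 + z * s ^+ 2) / u ^+ 2) (s * t / u) y)%R.
Proof.
move=> s0 t0 u.
have st0 : (0 < s ^+ 2 + t ^+ 2)%R by rewrite addr_gt0 ?exprn_gt0.
have u0 : (0 < u)%R by rewrite sqrtr_gt0.
have u2 : (u ^+ 2 = s ^+ 2 + t ^+ 2)%R by rewrite sqr_sqrtr// ltW.
have sn : s != 0%R by rewrite gt_eqF.
have tn : t != 0%R by rewrite gt_eqF.
have un : u != 0%R by rewrite gt_eqF.
rewrite !normal_pdfE ?mulf_neq0 ?invr_eq0//.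
rewrite /normal_fun mulrACA [RHS]mulrACA -!expRD; congr (_ * expR _)%R.
  rewrite /normal_peak -!mulrnAr.
  rewrite !(@sqrtrM _ (_ ^+ 2)) ?sqr_ge0// !sqrtr_sqr !gtr0_norm ?divr_gt0 ?mulr_gt0//.
  set q := Num.sqrt _.
  have q0 : q != 0%R by rewrite sqrtr_eq0 -ltNge pmulrn_lgt0// pi_gt0.
  by field; rewrite sn tn un q0.
have -> : ((s * t / u) ^+ 2 = s ^+ 2 * t ^+ 2 / u ^+ 2)%R.
  by rewrite !exprMn exprVn.
rewrite u2; field; rewrite sn tn gt_eqF//.
Qed.

(** The heat semigroup, indexed by standard deviation instead of time: variances add under
    composition, and [t = 0] is the identity. *)
Definition gauss_smooth (t : R) (f : R -> \bar R) (x : R) : \bar R :=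
  \int[gamma]_y f (x + t * y)%R.

Lemma measurable_gauss_smooth t f : measurable_fun setT f ->
  (forall x, 0 <= f x) -> measurable_fun setT (gauss_smooth t f).
Proof.
move=> mf f0.
apply: (@measurable_fun_fubini_tonelli_F _ _ _ _ _ gamma
  (fun z : R * R => f (z.1 + t * z.2)%R)) => //=.
apply: (measurableT_comp mf); apply: measurable_funD => //.
exact: measurable_funM.
Qed.

Lemma gauss_smooth_ge0 t f x : (forall x, 0 <= f x) -> 0 <= gauss_smooth t f x.
Proof. by move=> f0; exact: integral_ge0. Qed.

Lemma gauss_smooth0 f x : gauss_smooth 0 f x = f x.
Proof.
rewrite /gauss_smooth; under eq_integral do rewrite mul0r addr0.
by rewrite integral_cst//= probability_setT mule1.
Qed.

(** Semigroup law. With both smoothings written as densities, [normal_pdf_mul] isolates the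
    intermediate point in a single normal density; after Tonelli it integrates to 1. *)
Lemma gauss_smooth_comp (s t : R) (f : R -> \bar R) x :
  (0 <= s)%R -> (0 <= t)%R -> measurable_fun setT f -> (forall x, 0 <= f x) ->
  gauss_smooth s (gauss_smooth t f) x =
  gauss_smooth (Num.sqrt (s ^+ 2 + t ^+ 2)) f x.
Proof.
(* The density formulas need positive deviations, so [s = 0] and [t = 0] are treated apart. *)
rewrite le_eqVlt => /predU1P[<- t0 mf f0|s0].
  by rewrite gauss_smooth0 expr0n/= add0r sqrtr_sqr ger0_norm.
rewrite le_eqVlt => /predU1P[<- mf f0|t0 mf f0].
  rewrite expr0n/= addr0 sqrtr_sqr gtr0_norm// /gauss_smooth.
  by apply: eq_integral => y _; exact: gauss_smooth0.
set u := Num.sqrt _.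
have u0 : (0 < u)%R by rewrite sqrtr_gt0 addr_gt0 ?exprn_gt0.
have msf := measurable_gauss_smooth t mf f0.
have sf0 y : 0 <= gauss_smooth t f y by exact: gauss_smooth_ge0.
rewrite {1 3}/gauss_smooth -(@ge0_integral_normal_prob_affine x u _ u0 mf f0).
rewrite -(@ge0_integral_normal_prob_affine x s _ s0 msf sf0).
rewrite (ge0_integral_normal_prob _ _ mf f0).
rewrite (ge0_integral_normal_prob _ _ msf sf0).
have mpdf m r : measurable_fun setT (EFin \o normal_pdf m r).
  by apply/measurable_EFinP; exact: measurable_normal_pdf.
transitivity (\int[mu]_y \int[mu]_z
   (f z * (normal_pdf x s y * normal_pdf y t z)%:E)).
  apply: eq_integral => y _.
  rewrite /gauss_smooth -(@ge0_integral_normal_prob_affine y t _ t0 mf f0).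
  rewrite (ge0_integral_normal_prob _ _ mf f0) muleC -ge0_integralZl//; last 3 first.
  - by apply: emeasurable_funM; [exact: mf|exact: mpdf].
  - by move=> z _; rewrite mule_ge0// lee_fin normal_pdf_ge0.
  - by rewrite lee_fin normal_pdf_ge0.
  by apply: eq_integral => z _; rewrite muleCA EFinM.
transitivity (\int[mu]_y \int[mu]_z
   (f z * (normal_pdf x u z *
   normal_pdf ((x * t ^+ 2 + z * s ^+ 2) / u ^+ 2) (s * t / u) y)%:E)).
  by apply: eq_integral => y _; apply: eq_integral => z _; rewrite normal_pdf_mul.
rewrite (@fubini_tonelli _ _ _ _ _ mu mu (fun yz => (f yz.2 * (normal_pdf x u yz.2 *
   normal_pdf ((x * t ^+ 2 + yz.2 * s ^+ 2) / u ^+ 2) (s * t / u) yz.1)%:E)))//=; last 2 first.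
- apply: emeasurable_funM; first exact: measurableT_comp.
  apply/measurable_EFinP; apply: measurable_funM.
    by apply: measurableT_comp => //; exact: measurable_normal_pdf.
  have w0 : (s * t / u != 0)%R by rewrite !mulf_neq0 ?invr_eq0 ?gt_eqF.
  under eq_fun do rewrite normal_pdf_shift//.
  apply: measurableT_comp; first exact: measurable_normal_pdf.
  apply: measurable_funB => //; apply: measurable_funM => //.
  apply: measurable_funD => //; apply: measurable_funM => //.
- by move=> yz; rewrite mule_ge0// lee_fin mulr_ge0 ?normal_pdf_ge0.
apply: eq_integral => z _.
under eq_integral do rewrite EFinM muleA.
rewrite ge0_integralZl//; last 3 first.
- exact: mpdf.
- by move=> y _; rewrite lee_fin normal_pdf_ge0.
- by rewrite mule_ge0// lee_fin normal_pdf_ge0.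
by rewrite integral_normal_pdf mule1.
Qed.

End gauss.

(** * Sums of independent standard normal summands *)

Lemma ge0_integral_std_normal {d : measure_display} {T : measurableType d}
    {R : realType} (P : probability T R) (X : {RV P >-> R}) (f : R -> \bar R) :
  (forall A, measurable A -> distribution P X A = normal_prob 0 1 A) ->
  measurable_fun setT f -> (forall x, 0 <= f x)%E ->
  (\int[distribution P X]_x f x = \int[normal_prob (0 : R)%R 1%R]_x f x)%E.
Proof.
move=> lawX mf f0.
transitivity (\int[pushforward (normal_prob (0 : R) 1)
    (id : measurableTypeR R -> R)]_x f x)%E.
  by apply: eq_measure_integral => // A mA _; exact: lawX.
by rewrite ge0_integral_pushforward.
Qed.

Section joint_law.
Context {d : measure_display} {T : measurableType d} {R : realType}.
Variable P : probability T R.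
Local Open Scope ereal_scope.

(** A product formula on rectangles determines the measure on all measurable sets of the plane. The
    event [D], of weight [c], lets [partial_sum_independent] carry along the variables that are not
    yet summed. *)
Lemma joint_law_restr (X Y : {RV P >-> R}) (D : set T) (c : {nonneg R}) :
  measurable D ->
  (forall A B, measurable A -> measurable B ->
    P (X @^-1` A `&` (Y @^-1` B `&` D)) =
    P (X @^-1` A) * (P (Y @^-1` B) * c%:num%:E)) ->
  forall Z : set (R * R), measurable Z ->
    P ((fun w => (X w, Y w)) @^-1` Z `&` D) =
    c%:num%:E * (distribution P X \x distribution P Y) Z.
Proof.
move=> mD XYD Z mZ.
have mXY : measurable_fun setT (fun w => (X w, Y w)) by exact: measurable_fun_pair.
have H : forall A B : set R, measurable A -> measurable B ->
    pushforward (mrestr P mD) (fun w => (X w, Y w)) (A `*` B) =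
    mscale c (distribution P X) A * distribution P Y B.
  move=> A B mA mB.
  transitivity (P (X @^-1` A `&` (Y @^-1` B `&` D))).
    by rewrite setIA.
  rewrite XYD// [RHS](_ : _ = c%:num%:E * P (X @^-1` A) * P (Y @^-1` B))//.
  by rewrite (muleC (P (Y @^-1` B))) muleA (muleC _ c%:num%:E).
have := @product_measure_unique _ _ _ _ _ (mscale c (distribution P X))
  (distribution P Y)
  (measure_function_pushforward__canonical__measure_function_Measure (mrestr P mD) mXY)
  H Z mZ.
move=> E; transitivity ((mscale c (distribution P X) \x distribution P Y) Z).
  exact/esym/E.
rewrite /product_measure1 ge0_integral_mscale//.
exact: measurable_fun_xsection.
Qed.

Lemma joint_law_set (X Y : {RV P >-> R}) (Z : set (R * R)) :
  (forall A B, measurable A -> measurable B ->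
    P (X @^-1` A `&` Y @^-1` B) = P (X @^-1` A) * P (Y @^-1` B)) ->
  measurable Z ->
  P ((fun w => (X w, Y w)) @^-1` Z) = (distribution P X \x distribution P Y) Z.
Proof.
move=> XY mZ.
rewrite -[X in P X]setIT.
rewrite (@joint_law_restr X Y setT (NngNum (@ler01 R)))//; first by rewrite mul1e.
by move=> A B mA mB; rewrite setIT mule1 XY.
Qed.

Lemma joint_law (X Y : {RV P >-> R}) (F : R * R -> \bar R) :
  (forall A B, measurable A -> measurable B ->
    P (X @^-1` A `&` Y @^-1` B) = P (X @^-1` A) * P (Y @^-1` B)) ->
  measurable_fun setT F -> (forall z, 0 <= F z) ->
  \int[P]_w F (X w, Y w) = \int[P]_w \int[distribution P Y]_y F (X w, y).
Proof.
move=> XY mF F0.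
have mXY : measurable_fun setT (fun w => (X w, Y w)) by exact: measurable_fun_pair.
transitivity (\int[pushforward P (fun w => (X w, Y w))]_z F z).
  by rewrite ge0_integral_pushforward.
transitivity (\int[distribution P X \x distribution P Y]_z F z).
  apply: eq_measure_integral => Z mZ _.
  exact: joint_law_set.
rewrite fubini_tonelli1//.
rewrite ge0_integral_distribution//; first exact: measurable_fun_fubini_tonelli_F.
by move=> y; apply: integral_ge0.
Qed.

End joint_law.

Section partial_sums.
Context {d : measure_display} {T : measurableType d} {R : realType}.
Variables (P : probability T R) (eps : nat -> {RV P >-> R}).
Hypothesis heps : iid_std_normal eps.
Variable g : nat -> R -> R.
Hypothesis mg : forall i, measurable_fun setT (g i).
Local Notation gamma := (normal_prob (0 : R) 1).
Local Open Scope ereal_scope.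

(** The summand depends on the index because the shift differs between coordinates under an
    alternative; the null case uses a constant family. *)
Definition partial_sum (n : nat) (w : T) : R := (\sum_(i < n) g i (eps i w))%R.

Lemma measurable_partial_sum n : measurable_fun setT (partial_sum n).
Proof.
by apply: measurable_sum => i; exact: measurableT_comp.
Qed.

HB.instance Definition _ n :=
  isMeasurableFun.Build _ _ _ _ (partial_sum n) (measurable_partial_sum n).

Lemma partial_sumS n w :
  partial_sum n.+1 w = (partial_sum n w + g n (eps n w))%R.
Proof. by rewrite /partial_sum big_ord_recr. Qed.

(** Stated for any finite family of later variables, not for [eps n] alone: the induction step
    absorbs [eps n] into the sum and still needs it to be independent of the rest. *)
Lemma partial_sum_independent n (A : set R) (s : seq nat) (B : nat -> set R) :
  measurable A -> uniq s -> {in s, forall i, n <= i}%N ->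
  (forall i, measurable (B i)) ->
  P (partial_sum n @^-1` A `&` \bigcap_(i in [set` s]) (eps i @^-1` B i)) =
  P (partial_sum n @^-1` A) * \prod_(i <- s) P (eps i @^-1` B i).
Proof.
have [indep _] := heps.
elim: n A s B => [|n IHn] A s B mA us sn mB.
  have prodE : P (\bigcap_(i in [set` s]) (eps i @^-1` B i)) =
      \prod_(i <- s) P (eps i @^-1` B i).
    exact: indep.
  have -> : partial_sum 0 @^-1` A = if 0%R \in A then setT else set0.
    rewrite -(preimage_cst 0%R A); congr (_ @^-1` A).
    by apply/funext => w; rewrite /partial_sum big_ord0.
  case: ifP => _; first by rewrite setTI probability_setT mul1e.
  by rewrite set0I measure0 mul0e.
have ns : n \notin s by apply/negP => /sn; rewrite ltnn.
have sn' : {in n :: s, forall i, n <= i}%N.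
  by move=> i; rewrite inE => /predU1P[->//|/sn /ltnW].
pose D := \bigcap_(i in [set` s]) (eps i @^-1` B i).
have mD : measurable D.
  apply: fin_bigcap_measurable => [|i _]; first exact: finite_seq.
  by rewrite -[X in measurable X]setTI; exact: measurable_funP.
pose c := \prod_(i <- s) P (eps i @^-1` B i).
have c0 : 0 <= c by apply: prode_ge0 => i _.
have cfin : c \is a fin_num.
  by rewrite /c; apply: prode_fin_num => i _; apply: fin_num_measure;
    rewrite -[X in measurable X]setTI; exact: measurable_funP.
have cE : (NngNum (fine_ge0 c0))%:num%:E = c by rewrite /= fineK.
(* The event on the next partial sum, seen as a planar event for the pair
   [(partial_sum n, eps n)]. *)
pose Z : set (R * R) := (fun z => (z.1 + g n z.2)%R) @^-1` A.
have mZ : measurable Z.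
  rewrite -[Z]setTI; apply: (_ : measurable_fun setT _) => //.
  by apply: measurable_funD => //; exact: measurableT_comp.
have ZE : partial_sum n.+1 @^-1` A = (fun w => (partial_sum n w, eps n w)) @^-1` Z.
  by apply/seteqP; split => w /=; rewrite /Z /= partial_sumS.
have IHD (C : set R) (B' : set R) : measurable C -> measurable B' ->
    P (partial_sum n @^-1` C `&` (eps n @^-1` B' `&` D)) =
    P (partial_sum n @^-1` C) * (P (eps n @^-1` B') * c).
  move=> mC mB'.
  (* The induction hypothesis is used for the list [n :: s], with [B'] as the set at the new index
     [n]. *)
  pose B2 i := if i == n then B' else B i.
  have mB2 i : measurable (B2 i) by rewrite /B2; case: ifP.
  have B2s i : i \in s -> B2 i = B i.
    by move=> si; rewrite /B2; case: eqP => // ine; rewrite -ine si in ns.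
  have := IHn C (n :: s) B2 mC _ sn' mB2.
  rewrite /= ns us => /(_ isT).
  rewrite big_cons {2}/B2 eqxx (eq_big_seq (fun i => P (eps i @^-1` B i)));
    last by move=> i si; rewrite B2s.
  move=> <-.
  congr (P (_ `&` _)); apply/seteqP; split => [w [Bw Dw] i|w Dw].
    rewrite /= inE => /predU1P[->|si]; first by rewrite /B2 eqxx.
    by rewrite B2s//; exact: Dw.
  split; first by have := Dw n; rewrite /B2 eqxx; apply; rewrite /= mem_head.
  by move=> i /= si; rewrite -B2s//; apply: Dw; rewrite /= inE si orbT.
have IHT (C : set R) (B' : set R) : measurable C -> measurable B' ->
    P (partial_sum n @^-1` C `&` eps n @^-1` B') =
    P (partial_sum n @^-1` C) * P (eps n @^-1` B').
  move=> mC mB'.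
  have := IHn C [:: n] (fun=> B') mC isT.
  rewrite big_seq1 set_cons1 bigcap_set1; apply => // i.
  by rewrite inE => /eqP ->.
rewrite ZE -/D -/c.
have := @joint_law_restr _ _ _ P (partial_sum n) (eps n) D (NngNum (fine_ge0 c0)) mD.
rewrite cE => /(_ IHD _ mZ) ->.
by rewrite (joint_law_set IHT mZ) muleC.
Qed.

(** All later uses of independence, in the replacement argument and in the variance bound, go
    through this peeling of the last summand. *)
Lemma integral_partial_sumS n (F : R -> \bar R) :
  measurable_fun setT F -> (forall x, 0 <= F x) ->
  \int[P]_w F (partial_sum n.+1 w) =
  \int[P]_w \int[gamma]_y F (partial_sum n w + g n y)%R.
Proof.
move=> mF F0.
under eq_integral do rewrite partial_sumS.
have [_ law] := heps.
transitivity (\int[P]_w \int[distribution P (eps n)]_y F (partial_sum n w + g n y)%R); last first.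
  apply: eq_integral => w _; rewrite ge0_integral_std_normal//; first exact: law.
  by apply: (measurableT_comp mF); apply: measurable_funD.
apply: (@joint_law _ _ _ P (partial_sum n) (eps n) (fun z => F (z.1 + g n z.2)%R)) => //.
  move=> C B' mC mB'.
  have := @partial_sum_independent n C [:: n] (fun=> B') mC isT.
  rewrite big_seq1 set_cons1 bigcap_set1; apply => // i.
  by rewrite inE => /eqP ->.
apply: (measurableT_comp mF).
by apply: measurable_funD => //; exact: measurableT_comp.
Qed.

End partial_sums.

(** * Absolute moments of the standard normal distribution *)

Section gauss_moments.
Context {R : realType}.
Local Notation mu := (@lebesgue_measure R).
Local Notation gamma := (normal_prob (0 : R) 1).
Local Notation phi := (normal_pdf (0 : R) 1).

Lemma std_normal_pdfE (x : R) : phi x = normal_peak 1 * expR (- (x ^+ 2 / 2)).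
Proof.
by rewrite normal_pdfE ?oner_eq0// /normal_fun subr0 expr1n mulNr.
Qed.

Lemma is_derive_std_normal_pdf (x : R) : is_derive x 1 phi (- (x * phi x)).
Proof.
have -> : phi = (fun x => normal_peak 1 * expR (- (x ^+ 2 / 2))).
  by apply/funext => y; exact: std_normal_pdfE.
apply: is_derive_eq.
by rewrite /GRing.scale /=; field.
Qed.

Lemma cvg_std_normal_pdf : phi x @[x --> +oo] --> 0.
Proof.
have -> : phi = (fun x => normal_peak 1 * expR (- (x ^+ 2 / 2))).
  by apply/funext => y; exact: std_normal_pdfE.
rewrite -[X in _ --> X](mulr0 (normal_peak 1)).
apply: cvgMr.
apply: (@cvg_comp _ _ _ (fun x : R => x ^+ 2 / 2) (fun x => expR (- x)) _ (pinfty_nbhs R)).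
  by apply: gt0_cvgMly => //; exact: cvgr_expr2.
exact: cvgr_expR.
Qed.

Lemma integral_std_normal_tail (x : R) : 0 <= x ->
  (\int[mu]_(y in `[x, +oo[) (y * phi y)%:E = (phi x)%:E)%E.
Proof.
move=> x0.
have dphi y := is_derive_std_normal_pdf y.
have cphi : continuous phi by apply: continuous_normal_pdf; exact: oner_neq0.
rewrite (@ge0_continuous_FTC2y _ _ (fun y => - phi y) _ 0).
- by rewrite EFinN oppeK add0e.
- by move=> y xy; rewrite mulr_ge0 ?normal_pdf_ge0// (le_trans x0).
- apply: continuous_subspaceT => y; apply: cvgM; [exact: cvg_id|exact: cphi].
- by rewrite -[X in _ --> X]oppr0; apply: cvgN; exact: cvg_std_normal_pdf.
- by move=> y _; apply: derivableN; exact: ex_derive.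
- by apply: cvgN; apply: cvg_at_right_filter; exact: cphi.
- move=> y _; rewrite derive1E deriveN//.
  by rewrite derive_val opprK.
Qed.

Lemma integral_exprn (n : nat) (y : R) : 0 <= y ->
  (\int[mu]_(x in `[0%R, y]) (n.+1%:R * x ^+ n)%:E = (y ^+ n.+1)%:E)%E.
Proof.
rewrite le_eqVlt => /predU1P[<-|y0].
  by rewrite set_itv1 integral_set1 expr0n.
have dF (x : R) : is_derive x 1 (fun x => x ^+ n.+1) (n.+1%:R * x ^+ n).
  apply: DeriveDef; first exact: exprn_derivable.
  by rewrite exp_derive /GRing.scale/= mulr1.
rewrite (@continuous_FTC2 _ _ (fun x => x ^+ n.+1) _ _ y0).
- by rewrite expr0n/= sube0.
- apply: continuous_subspaceT => x; apply: cvgM; first exact: cvg_cst.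
  exact: exprn_continuous.
- split => [x _||].
  + exact: ex_derive.
  + by apply: cvg_at_right_filter; exact: exprn_continuous.
  + by apply: cvg_at_left_filter; exact: exprn_continuous.
- by move=> x _; rewrite derive1E derive_val.
Qed.

Definition gauss_moment (n : nat) : \bar R := (\int[gamma]_x (`|x| ^+ n)%:E)%E.

Local Open Scope ereal_scope.

Lemma gauss_momentE n :
  gauss_moment n = 2%:E * \int[mu]_(x in `[0%R, +oo[) (x ^+ n * phi x)%:E.
Proof.
rewrite /gauss_moment ge0_integral_normal_prob//; last first.
  by apply/measurable_EFinP; apply: measurable_funX.
under eq_integral do rewrite -EFinM.
rewrite ge0_symfun_integralT//; last first.
- by move=> x; rewrite /= normrN normal_pdfN.
- move=> x; apply: cvgM; last first.
    by apply: continuous_normal_pdf; exact: oner_neq0.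
  apply: (@continuous_comp _ _ _ (fun x : R => `|x|%R) (fun x => x ^+ n)%R).
    exact: norm_continuous.
  exact: exprn_continuous.
- by move=> x; rewrite mulr_ge0 ?exprn_ge0 ?normal_pdf_ge0.
congr (_ * _); rewrite -set_itvcy; apply: eq_integral => x.
by rewrite inE/= in_itv/= andbT => x0; rewrite ger0_norm.
Qed.

(** Integration by parts carried out as a Tonelli exchange over [0 <= x <= y]. Integrating the
    kernel [K] in [x] first produces [y^(n+2) phi y]; integrating in [y] first produces
    [(n+1) x^n phi x], because [- phi] is a primitive of [y phi y]. *)
Lemma gauss_moment_rec n : gauss_moment n.+2 = n.+1%:R%:E * gauss_moment n.
Proof.
rewrite !gauss_momentE muleCA; congr (_ * _).
pose K (z : R * R) : \bar R :=
  ((n.+1%:R * z.1 ^+ n * (z.2 * phi z.2) * ((0 <= z.1)%R && (z.1 <= z.2)%R)%:R)%R)%:E.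
have mK : measurable_fun setT K.
  apply/measurable_EFinP; apply: measurable_funM.
    apply: measurable_funM; apply: measurable_funM => //.
      exact: measurable_funX.
    by apply: measurableT_comp => //; exact: measurable_normal_pdf.
  have -> : (fun z : R * R => ((0 <= z.1)%R && (z.1 <= z.2)%R)%:R : R) =
    (fun b : bool => b%:R) \o (fun z : R * R => (0 <= z.1)%R && (z.1 <= z.2)%R) by [].
  apply: measurableT_comp => //.
  by apply: measurable_and; apply: measurable_fun_ler.
have K0 z : 0 <= K z.
  rewrite lee_fin /K; case: andP => [[z1 z2]|]; last by rewrite mulr0.
  by rewrite !mulr_ge0 ?exprn_ge0 ?normal_pdf_ge0// (le_trans z1).
transitivity (\int[mu]_y \int[mu]_x K (x, y)).
  rewrite integral_mkcond; apply: eq_integral => y _.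
  rewrite patchE; case: ifPn => [|]; rewrite ?inE ?notin_setE/= in_itv/= andbT => y0.
    transitivity (\int[mu]_(x in `[0%R, y]) ((y * phi y)%:E * (n.+1%:R * x ^+ n)%:E)).
      rewrite ge0_integralZl//.
      + by rewrite integral_exprn// -EFinM exprSr exprSr; congr EFin; ring.
      + by apply/measurable_EFinP/measurable_funTS/measurable_funM => //; exact: measurable_funX.
      + by move=> x; rewrite /= in_itv/= => /andP[x0 _]; rewrite lee_fin mulr_ge0// exprn_ge0.
      + by rewrite lee_fin mulr_ge0// normal_pdf_ge0.
    rewrite integral_mkcond; apply: eq_integral => x _.
    rewrite patchE /K/= mem_setE in_itv/=; case: ifPn => _.
      by rewrite -EFinM mulr1; congr EFin; ring.
    by rewrite mulr0.
  rewrite integral0_eq// => x _; rewrite /K/=.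
  case: (boolP (_ && _)) => [/andP[x0 xy]|]; last by rewrite mulr0.
  by case: y0; exact: le_trans xy.
rewrite -(@fubini_tonelli _ _ _ _ _ mu mu K)//.
rewrite -ge0_integralZl//; last 2 first.
- apply/measurable_EFinP/measurable_funTS/measurable_funM => //.
  exact: measurable_normal_pdf.
- by move=> x; rewrite /= in_itv/= andbT => x0; rewrite lee_fin mulr_ge0 ?exprn_ge0 ?normal_pdf_ge0.
rewrite [RHS]integral_mkcond; apply: eq_integral => x _.
rewrite patchE; case: ifPn => [|]; rewrite ?inE ?notin_setE/= in_itv/= andbT => x0.
  rewrite [RHS](_ : _ = (n.+1%:R * x ^+ n)%:E * (phi x)%:E); last by rewrite -!EFinM mulrA.
  rewrite -integral_std_normal_tail// -ge0_integralZl//; last 3 first.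
  - apply/measurable_EFinP/measurable_funTS/measurable_funM => //; exact: measurable_normal_pdf.
  - move=> y; rewrite /= in_itv/= andbT => xy; rewrite lee_fin mulr_ge0 ?normal_pdf_ge0//.
    exact: le_trans xy.
  - by rewrite lee_fin mulr_ge0// exprn_ge0.
  rewrite [RHS]integral_mkcond; apply: eq_integral => y _.
  rewrite patchE /K/= mem_setE in_itv/= andbT x0/=; case: ifPn => _.
    by rewrite -EFinM mulr1.
  by rewrite mulr0.
rewrite integral0_eq// => y _; rewrite /K/=.
by move/negP/negbTE: x0 => ->; rewrite mulr0.
Qed.

Lemma gauss_moment0 : gauss_moment 0 = 1.
Proof.
rewrite /gauss_moment; under eq_integral do rewrite expr0.
by rewrite integral_cst//= probability_setT mule1.
Qed.

Lemma gauss_moment_ge0 n : 0 <= gauss_moment n.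
Proof. by apply: integral_ge0 => x _; rewrite lee_fin exprn_ge0. Qed.

(** From [|x| <= 1 + x^2]. It supplies the finite base case of the odd moments. *)
Lemma gauss_moment1_le : gauss_moment 1 <= 2%:E.
Proof.
have -> : 2%:E = gauss_moment 0 + gauss_moment 2.
  by rewrite gauss_moment_rec gauss_moment0 mule1 -EFinD.
rewrite /gauss_moment -ge0_integralD//.
- apply: ge0_le_integral => //=.
  + by apply/measurable_EFinP; exact: measurable_funX.
  + apply: emeasurable_funD; apply/measurable_EFinP; exact: measurable_funX.
  + move=> x _; rewrite -EFinD lee_fin expr1 expr0; nra.
- by apply/measurable_EFinP; exact: measurable_funX.
- by apply/measurable_EFinP; exact: measurable_funX.
Qed.

Lemma gauss_moment_fin_num n : gauss_moment n \is a fin_num.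
Proof.
elim/ltn_ind: n => -[|[|n]] IH.
- by rewrite gauss_moment0.
- rewrite ge0_fin_numE ?gauss_moment_ge0//.
  by rewrite (le_lt_trans gauss_moment1_le)// ltry.
- by rewrite gauss_moment_rec fin_numM// IH.
Qed.

End gauss_moments.

Section gauss_expectation.
Context {R : realType}.
Local Notation gamma := (normal_prob (0 : R) 1).
Implicit Types (f g : R -> R).

Definition gauss_integrable f := gamma.-integrable setT (EFin \o f).
Definition gauss_mean f : R := Rintegral gamma setT f.

Lemma gauss_integrable_measurable f : gauss_integrable f -> measurable_fun setT f.
Proof. by move=> /measurable_int /measurable_EFinP. Qed.

Lemma gauss_integrable_le f g : measurable_fun setT f ->
  (forall x, `|f x| <= g x) -> gauss_integrable g -> gauss_integrable f.
Proof.
move=> mf fg ig; apply: (le_integrable _ _ _ ig) => //.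
- exact/measurable_EFinP.
- by move=> x _; rewrite /= lee_fin (le_trans (fg x))// ler_norm.
Qed.

Lemma gauss_integrable_cst c : gauss_integrable (fun=> c).
Proof. exact: finite_measure_integrable_cst. Qed.

Lemma gauss_integrableD f g : gauss_integrable f -> gauss_integrable g ->
  gauss_integrable (fun x => f x + g x).
Proof. by move=> fi gi; exact: (integrableD measurableT fi gi). Qed.

Lemma gauss_integrableB f g : gauss_integrable f -> gauss_integrable g ->
  gauss_integrable (fun x => f x - g x).
Proof. by move=> fi gi; exact: (integrableB measurableT fi gi). Qed.

Lemma gauss_integrableZ c f : gauss_integrable f ->
  gauss_integrable (fun x => c * f x).
Proof. by move=> fi; exact: (integrableZl measurableT c fi). Qed.

Lemma gauss_integrable_bounded f c : measurable_fun setT f ->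
  (forall x, `|f x| <= c) -> gauss_integrable f.
Proof. by move=> mf fc; exact: gauss_integrable_le (gauss_integrable_cst c). Qed.

Lemma gauss_meanE f : gauss_integrable f ->
  (gauss_mean f)%:E = (\int[gamma]_x (f x)%:E)%E.
Proof. by move=> fi; rewrite fineK//; exact: integrable_fin_num. Qed.

Lemma gauss_mean_cst c : gauss_mean (fun=> c) = c.
Proof. rewrite /gauss_mean Rintegral_cst//.
by rewrite [X in fine X](_ : _ = 1%E) ?mulr1//; exact: probability_setT. Qed.

Lemma gauss_meanD f g : gauss_integrable f -> gauss_integrable g ->
  gauss_mean (fun x => f x + g x) = gauss_mean f + gauss_mean g.
Proof. by move=> fi gi; exact: RintegralD. Qed.

Lemma gauss_meanB f g : gauss_integrable f -> gauss_integrable g ->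
  gauss_mean (fun x => f x - g x) = gauss_mean f - gauss_mean g.
Proof. by move=> fi gi; exact: RintegralB. Qed.

Lemma gauss_meanZ c f : gauss_integrable f ->
  gauss_mean (fun x => c * f x) = c * gauss_mean f.
Proof. by move=> fi; exact: RintegralZl. Qed.

Lemma le_gauss_mean f g : gauss_integrable f -> gauss_integrable g ->
  (forall x, f x <= g x) -> gauss_mean f <= gauss_mean g.
Proof. by move=> fi gi fg; apply: le_Rintegral. Qed.

Lemma eq_gauss_mean f g : (forall x, f x = g x) -> gauss_mean f = gauss_mean g.
Proof. by move=> /funext ->. Qed.

Lemma gauss_mean_norm_le f g : gauss_integrable f -> gauss_integrable g ->
  (forall x, `|f x| <= g x) -> `|gauss_mean f| <= gauss_mean g.
Proof.
move=> fi gi fg; apply: (le_trans (le_normr_Rintegral measurableT fi)).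
apply: le_Rintegral => //; exact: integrable_norm.
Qed.

Lemma gauss_integrableN f : gauss_integrable f -> gauss_integrable (fun x => f (- x)).
Proof.
move=> fi; have mf := gauss_integrable_measurable fi.
have mfN : measurable_fun setT (fun x : R => f (- x)).
  by apply: (measurableT_comp mf); exact: measurable_funN.
apply/integrableP; split; first exact/measurable_EFinP.
move/integrableP : fi => [_]; rewrite -ge0_integral_gaussN//.
by apply: measurableT_comp => //; exact/measurable_EFinP.
Qed.

Lemma ge0_gauss_meanN f : measurable_fun setT f -> (forall x, 0 <= f x) ->
  gauss_mean (fun x => f (- x)) = gauss_mean f.
Proof.
move=> mf f0; rewrite /gauss_mean /Rintegral.
rewrite (@ge0_integral_gaussN _ (EFin \o f))//; exact/measurable_EFinP.
Qed.

Lemma gauss_integrable_norm_exp n : gauss_integrable (fun x => `|x| ^+ n).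
Proof.
apply/integrableP; split; first by apply/measurable_EFinP; exact: measurable_funX.
rewrite (eq_integral (fun x : measurableTypeR R => (`|x : R| ^+ n)%:E)); last first.
  by move=> x _; rewrite /= ger0_norm// exprn_ge0.
by rewrite -ge0_fin_numE ?gauss_moment_ge0//; exact: gauss_moment_fin_num.
Qed.

Definition gauss_absmom n : R := gauss_mean (fun x => `|x| ^+ n).

Lemma gauss_absmomE n : (gauss_absmom n)%:E = gauss_moment n.
Proof. by rewrite gauss_meanE//; exact: gauss_integrable_norm_exp. Qed.

Lemma gauss_absmom0 : gauss_absmom 0 = 1.
Proof. by apply: EFin_inj; rewrite gauss_absmomE gauss_moment0. Qed.

Lemma gauss_absmomSS n : gauss_absmom n.+2 = n.+1%:R * gauss_absmom n.
Proof.
by apply: EFin_inj; rewrite EFinM !gauss_absmomE gauss_moment_rec.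
Qed.

Lemma gauss_absmom2 : gauss_absmom 2 = 1.
Proof. by rewrite gauss_absmomSS gauss_absmom0 mulr1. Qed.

Lemma gauss_absmom3 : gauss_absmom 3 = 2 * gauss_absmom 1.
Proof. exact: gauss_absmomSS. Qed.

Lemma gauss_absmom4 : gauss_absmom 4 = 3.
Proof. by rewrite gauss_absmomSS gauss_absmom2 mulr1. Qed.

Lemma gauss_absmom_ge0 n : 0 <= gauss_absmom n.
Proof. by apply: Rintegral_ge0 => x _; rewrite exprn_ge0. Qed.

(* Integrate 2 t |x|^3 <= t^2 x^2 + x^4 and take t = 2 E|x|. *)
Lemma gauss_absmom1_sqr_le : gauss_absmom 1 ^+ 2 <= 3 / 4.
Proof.
have H t : 2 * t * gauss_absmom 3 <= t ^+ 2 * gauss_absmom 2 + gauss_absmom 4.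
  have i := gauss_integrable_norm_exp.
  rewrite -!gauss_meanZ// -gauss_meanD//; last exact: gauss_integrableZ.
  apply: le_gauss_mean.
  - exact: gauss_integrableZ.
  - by apply: gauss_integrableD => //; exact: gauss_integrableZ.
  - move=> x; rewrite -subr_ge0.
    have -> : t ^+ 2 * `|x| ^+ 2 + `|x| ^+ 4 - 2 * t * `|x| ^+ 3 =
      (`|x| * (t - `|x|)) ^+ 2 by ring.
    exact: sqr_ge0.
have := H (2 * gauss_absmom 1).
rewrite !gauss_absmomSS gauss_absmom0; lra.
Qed.

(** Integrating [|x| (1 - |x|)^2 >= 0] gives [2 <= 3 E|x|], with no need for the exact value
    [sqrt(2/pi)]. *)
Lemma gauss_absmom1_gt0 : 0 < gauss_absmom 1.
Proof.
have H : 2 * gauss_absmom 2 <= gauss_absmom 1 + gauss_absmom 3.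
  have i := gauss_integrable_norm_exp.
  rewrite -!gauss_meanZ// -gauss_meanD//.
  apply: le_gauss_mean.
  - exact: gauss_integrableZ.
  - exact: gauss_integrableD.
  - move=> x; rewrite -subr_ge0.
    have -> : `|x| ^+ 1 + `|x| ^+ 3 - 2 * `|x| ^+ 2 = `|x| * (1 - `|x|) ^+ 2 by ring.
    by rewrite mulr_ge0// sqr_ge0.
by move: H; rewrite !gauss_absmomSS gauss_absmom0; lra.
Qed.

Lemma gauss_absmom_gt0 n : 0 < gauss_absmom n.
Proof.
elim/ltn_ind: n => -[|[|n]] IH; first by rewrite gauss_absmom0.
  exact: gauss_absmom1_gt0.
by rewrite gauss_absmomSS mulr_gt0// IH.
Qed.

(** A strict improvement of Jensen by a factor uniform in [n]; it keeps the variance comparable to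
    the second moment. Induction in steps of two rests on [(n+2)^2 <= (2n+5)(2n+3)], and [n = 0] is
    excluded because the variable is then constant. *)
Lemma gauss_absmom_sqr_le n : (0 < n)%N ->
  gauss_absmom n ^+ 2 <= 3 / 4 * gauss_absmom (2 * n).
Proof.
elim/ltn_ind: n => -[//|[|[|n]]] IH _.
- by rewrite gauss_absmom2 mulr1; exact: gauss_absmom1_sqr_le.
- by rewrite (_ : 2 * 2 = 4)%N// gauss_absmom4 gauss_absmom2; lra.
have {IH} := IH n.+1 (leqnSn _) isT.
rewrite (_ : 2 * n.+3 = (2 * n.+1).+4)%N; last by lia.
rewrite (gauss_absmomSS n.+1) (gauss_absmomSS (2 * n.+1).+2) (gauss_absmomSS (2 * n.+1)).
set a := gauss_absmom n.+1; set b := gauss_absmom (2 * n.+1) => ab.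
have b0 : 0 <= b by exact: gauss_absmom_ge0.
rewrite exprMn.
apply: (le_trans (ler_wpM2l (sqr_ge0 _) ab)).
rewrite mulrCA ler_pM2l// mulrA ler_wpM2r//.
by rewrite -natrX -natrM ler_nat; nia.
Qed.

(* From n to n + 2 the ratio of the left side to gauss_absmom (2 * n) ^+ 3 is multiplied by
   [(3n+5)(3n+3)(3n+1)]^2 / [(2n+3)(2n+1)]^3, which stays below its limit (27/8)^2; this is
   the origin of the growth (3/2)^(3 p_d / 2) in the rate condition. *)
Lemma gauss_absmom3_sqr_le n :
  gauss_absmom (3 * n) ^+ 2 <= (27 / 8) ^+ n * gauss_absmom (2 * n) ^+ 3.
Proof.
elim/ltn_ind: n => -[|[|n]] IH.
- by rewrite muln0 gauss_absmom0 !expr1n expr0 mulr1.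
- rewrite !muln1 gauss_absmom3 gauss_absmom2; have := gauss_absmom1_sqr_le.
  by rewrite expr1; lra.
have {IH} := IH n (leqW (leqnn _)).
rewrite (_ : 2 * n.+2 = (2 * n).+4)%N; last by lia.
rewrite (_ : 3 * n.+2 = (3 * n).+4.+2)%N; last by lia.
rewrite !gauss_absmomSS.
set a := gauss_absmom (3 * n); set b := gauss_absmom (2 * n) => ab.
have b0 : 0 <= b by exact: gauss_absmom_ge0.
set p := _ ^+ n in ab *.
have p0 : 0 <= p by rewrite exprn_ge0// divr_ge0.
have -> : (27 / 8 : R) ^+ n.+2 = (27 / 8) ^+ 2 * p by rewrite -exprD.
set x := n%:R : R.
have x0 : 0 <= x by [].
have e3 c : (c + 3 * n)%:R = 3 * x + c%:R :> R by rewrite natrD natrM addrC.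
have e2 c : (c + 2 * n)%:R = 2 * x + c%:R :> R by rewrite natrD natrM addrC.
have := (e3 5, (e3 3, e3 1), (e2 3, e2 1))%N.
rewrite /= => -[[-> [-> ->]] [-> ->]].
have -> : ((3 * x + 5) * ((3 * x + 3) * ((3 * x + 1) * a))) ^+ 2 =
  ((3 * x + 5) * (3 * x + 3) * (3 * x + 1)) ^+ 2 * a ^+ 2 by ring.
have -> : (27 / 8) ^+ 2 * p * ((2 * x + 3) * ((2 * x + 1) * b)) ^+ 3 =
  (27 / 8) ^+ 2 * ((2 * x + 3) * (2 * x + 1)) ^+ 3 * (p * b ^+ 3) by ring.
apply: ler_pM => //; rewrite ?sqr_ge0//.
rewrite -subr_ge0.
(* In the variable [X = x + 1] the products become [(4X^2 - 1)^3] and [9 X^2 (9X^2 - 4)^2]. The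
   factor [(27/8)^2] cancels the sixth powers, and the remainder is positive for [X >= 1]. *)
have -> : (27 / 8) ^+ 2 * ((2 * x + 3) * (2 * x + 1)) ^+ 3 -
  ((3 * x + 5) * (3 * x + 3) * (3 * x + 1)) ^+ 2 =
  729 * (5 / 36 * (x + 1) ^+ 4 - (16 / 81 - 3 / 16) * (x + 1) ^+ 2 - 1 / 64) by field.
nra.
Qed.

(** Jensen for the cube through its tangent at the mean [a]: [t^3 - 3 a^2 t + 2 a^3 = (t - a)^2 (t +
    2a)]. *)
Lemma gauss_absmom_cube_le n : gauss_absmom n ^+ 3 <= gauss_absmom (3 * n).
Proof.
set a := gauss_absmom n.
have i := gauss_integrable_norm_exp.
have a0 : 0 <= a by exact: gauss_absmom_ge0.
have : 3 * a ^+ 2 * gauss_absmom n - gauss_mean (fun=> 2 * a ^+ 3) <= gauss_absmom (3 * n).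
  rewrite -gauss_meanZ// -gauss_meanB//; last 2 first.
  - exact: gauss_integrableZ.
  - exact: gauss_integrable_cst.
  apply: le_gauss_mean => //.
    by apply: gauss_integrableB; [exact: gauss_integrableZ|exact: gauss_integrable_cst].
  move=> x; rewrite mulnC exprM -subr_ge0; set t := _ ^+ n.
  have t0 : 0 <= t by rewrite exprn_ge0.
  have -> : t ^+ 3 - (3 * a ^+ 2 * t - 2 * a ^+ 3) = (t - a) ^+ 2 * (t + 2 * a) by ring.
  by rewrite mulr_ge0 ?sqr_ge0// addr_ge0// mulr_ge0.
by rewrite gauss_mean_cst -/a; lra.
Qed.

Definition gauss_var n : R := gauss_absmom (2 * n) - gauss_absmom n ^+ 2.

Lemma gauss_var_ge n : (0 < n)%N -> gauss_absmom (2 * n) / 4 <= gauss_var n.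
Proof. by move=> /gauss_absmom_sqr_le; rewrite /gauss_var; lra. Qed.

Lemma gauss_var_gt0 n : (0 < n)%N -> 0 < gauss_var n.
Proof.
move=> /gauss_var_ge; apply: lt_le_trans.
by rewrite divr_gt0 ?gauss_absmom_gt0.
Qed.

End gauss_expectation.

(** * Lindeberg replacement *)

Section smoothing.
Context {R : realType}.
Implicit Types (f g u v : R -> R).

(** Real-valued counterpart of [gauss_smooth], suited to the signed functions in a Taylor expansion;
    [smoothE] links the two on measurable functions with values in [[0, 1]]. *)
Definition smooth (t : R) f (x : R) : R := gauss_mean (fun y => f (x + t * y)).

Definition unit_valued f := forall x, 0 <= f x <= 1.

(* Second order Taylor estimate with cubic remainder; [f2] is half the second derivative. *)
Definition taylor_bound (K : R) f f1 f2 :=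
  forall x y, `|f (x + y) - f x - f1 x * y - f2 x * y ^+ 2| <= K * `|y| ^+ 3.

Lemma measurable_shift x t f : measurable_fun setT f ->
  measurable_fun setT (fun y : R => f (x + t * y)).
Proof. by move=> mf; exact: (measurableT_comp mf (measurable_affine x t)). Qed.

Lemma smoothE t f x : measurable_fun setT f -> unit_valued f ->
  (smooth t f x)%:E = gauss_smooth t (EFin \o f) x.
Proof.
move=> mf uf; rewrite gauss_meanE//.
apply: (@gauss_integrable_bounded _ _ 1); first exact: measurable_shift.
by move=> y; have /andP[f0 f1] := uf (x + t * y); rewrite ger0_norm.
Qed.

Lemma unit_valued_integrable f x u : measurable_fun setT f -> unit_valued f ->
  measurable_fun setT u -> gauss_integrable (fun y => f (x + u y)).
Proof.
move=> mf uf mu; apply: (@gauss_integrable_bounded _ _ 1).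
  by apply: (measurableT_comp mf); exact: measurable_funD.
by move=> y; have /andP[f0 f1] := uf (x + u y); rewrite ger0_norm.
Qed.

Lemma measurable_smooth t f : measurable_fun setT f -> unit_valued f ->
  measurable_fun setT (smooth t f).
Proof.
move=> mf uf; apply/measurable_EFinP.
rewrite (_ : _ \o _ = gauss_smooth t (EFin \o f)); last first.
  by apply/funext => x; exact: smoothE.
apply: measurable_gauss_smooth; first exact/measurable_EFinP.
by move=> x; rewrite lee_fin; case/andP: (uf x).
Qed.

Lemma smooth_unit_valued t f : measurable_fun setT f -> unit_valued f ->
  unit_valued (smooth t f).
Proof.
move=> mf uf x; have i : gauss_integrable (fun y => f (x + t * y)).
  by apply: unit_valued_integrable => //; exact: measurable_funM.
rewrite -[X in X <= _ <= _](@gauss_mean_cst R) -[X in _ <= _ <= X](@gauss_mean_cst R).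
by apply/andP; split; apply: le_gauss_mean => //; try exact: gauss_integrable_cst;
  move=> y; case/andP: (uf (x + t * y)).
Qed.

Lemma smooth0 f : smooth 0 f = f.
Proof.
apply/funext => x; rewrite /smooth -[RHS](@gauss_mean_cst R).
by apply: eq_gauss_mean => y; rewrite mul0r addr0.
Qed.

Lemma smooth_comp s t f : 0 <= s -> 0 <= t -> measurable_fun setT f ->
  unit_valued f -> smooth s (smooth t f) = smooth (Num.sqrt (s ^+ 2 + t ^+ 2)) f.
Proof.
move=> s0 t0 mf uf; apply/funext => x; apply: EFin_inj.
have msf := measurable_smooth t mf uf.
have usf := smooth_unit_valued t mf uf.
rewrite !smoothE// -gauss_smooth_comp//; last 2 first.
- exact/measurable_EFinP.
- by move=> y; rewrite lee_fin; case/andP: (uf y).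
congr gauss_smooth; apply/funext => y; exact: smoothE.
Qed.

(** The Taylor inequality at [x + t * z] is averaged over [z], so [K] does not depend on [t]. The
    bound [B] serves only the integrability of [f1] and [f2]. *)
Lemma smooth_taylor_bound t K f f1 f2 (B : R) :
  measurable_fun setT f -> measurable_fun setT f1 -> measurable_fun setT f2 ->
  unit_valued f -> (forall x, `|f1 x| <= B) -> (forall x, `|f2 x| <= B) ->
  taylor_bound K f f1 f2 ->
  taylor_bound K (smooth t f) (smooth t f1) (smooth t f2).
Proof.
move=> mf mf1 mf2 uf B1 B2 tf x y.
have i0 (v : R) : gauss_integrable (fun z => f (v + t * z)).
  by apply: unit_valued_integrable => //; exact: measurable_funM.
have i1 : gauss_integrable (fun z => f1 (x + t * z)).
  by apply: (@gauss_integrable_bounded _ _ B); [exact: measurable_shift|].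
have i2 : gauss_integrable (fun z => f2 (x + t * z)).
  by apply: (@gauss_integrable_bounded _ _ B); [exact: measurable_shift|].
rewrite /smooth [_ * y]mulrC [_ * y ^+ 2]mulrC -!gauss_meanZ//.
have i3 := gauss_integrableB (i0 (x + y)) (i0 x).
have i4 := gauss_integrableB i3 (gauss_integrableZ y i1).
have i5 := gauss_integrableB i4 (gauss_integrableZ (y ^+ 2) i2).
rewrite -(gauss_meanB (i0 (x + y)) (i0 x)) -(gauss_meanB i3 (gauss_integrableZ y i1)).
rewrite -(gauss_meanB i4 (gauss_integrableZ (y ^+ 2) i2)).
rewrite -[leRHS](@gauss_mean_cst R); apply: gauss_mean_norm_le => //.
  exact: gauss_integrable_cst.
move=> z; have := tf (x + t * z) y.
by rewrite [x + y + _]addrAC (mulrC (f1 _)) (mulrC (f2 _)).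
Qed.

(** The linear term integrates to zero and the quadratic one sees only the variance. Hence two
    centred summands of equal variance have nearly the same effect, up to their third moments. *)
Lemma taylor_mean K f f1 f2 x u (s2 b : R) :
  measurable_fun setT f -> unit_valued f -> taylor_bound K f f1 f2 ->
  0 <= K ->
  gauss_integrable u -> gauss_integrable (fun y => u y ^+ 2) ->
  gauss_integrable (fun y => `|u y| ^+ 3) ->
  gauss_mean u = 0 -> gauss_mean (fun y => u y ^+ 2) = s2 ->
  gauss_mean (fun y => `|u y| ^+ 3) <= b ->
  `|gauss_mean (fun y => f (x + u y)) - f x - f2 x * s2| <= K * b.
Proof.
move=> mf uf tf K0 iu iu2 iu3 u0 us2 ub.
have mu := gauss_integrable_measurable iu.
have i0 : gauss_integrable (fun y => f (x + u y)) by exact: unit_valued_integrable.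
have ic : gauss_integrable (fun=> f x) by exact: gauss_integrable_cst.
have i1 := gauss_integrableB i0 ic.
have i2 := gauss_integrableB i1 (gauss_integrableZ (f1 x) iu).
have i3 := gauss_integrableB i2 (gauss_integrableZ (f2 x) iu2).
have E : gauss_mean (fun y => f (x + u y)) - f x - f2 x * s2 =
    gauss_mean (fun y => f (x + u y) - f x - f1 x * u y - f2 x * u y ^+ 2).
  rewrite (gauss_meanB i2 (gauss_integrableZ (f2 x) iu2)).
  rewrite (gauss_meanB i1 (gauss_integrableZ (f1 x) iu)) (gauss_meanB i0 ic).
  by rewrite !gauss_meanZ// u0 us2 mulr0 subr0 gauss_mean_cst.
rewrite E; apply: (@le_trans _ _ (gauss_mean (fun y => K * `|u y| ^+ 3))).
  by apply: gauss_mean_norm_le => //; exact: gauss_integrableZ.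
by rewrite gauss_meanZ// ler_wpM2l.
Qed.

End smoothing.

Section gauss_odd.
Context {R : realType}.

Lemma gauss_meanN (f : R -> R) : gauss_integrable f ->
  gauss_mean (fun x => f (- x)) = gauss_mean f.
Proof.
move=> fi; have mf := gauss_integrable_measurable fi.
have nfi : gauss_integrable (fun x => `|f x|).
  exact: integrable_norm.
have fni := gauss_integrableD fi nfi.
(* Symmetry is known for nonnegative functions; [g] is the difference of [g + |g|] and [|g|]. *)
have split (g : R -> R) : gauss_integrable g -> gauss_integrable (fun x => `|g x|) ->
    gauss_mean g = gauss_mean (fun x => g x + `|g x|) - gauss_mean (fun x => `|g x|).
  by move=> gi ngi; rewrite gauss_meanD// addrK.
rewrite (split f)// (split (fun x => f (- x))); last 2 first.
- exact: gauss_integrableN.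
- exact: (gauss_integrableN nfi).
rewrite (@ge0_gauss_meanN R (fun x => f x + `|f x|)); last 2 first.
- exact: gauss_integrable_measurable.
- by move=> x; have := ler_norm (- f x); rewrite normrN; lra.
by rewrite (@ge0_gauss_meanN R (fun x => `|f x|))//; exact: measurableT_comp.
Qed.

Lemma gauss_integrable_id : gauss_integrable (@id R).
Proof.
apply: (gauss_integrable_le _ _ (gauss_integrable_norm_exp 1)) => // x.
Qed.

Lemma gauss_mean_id : gauss_mean (@id R) = 0.
Proof.
have := gauss_meanN gauss_integrable_id.
have -> : gauss_mean (fun x : R => id (- x)) = gauss_mean (fun x => -1 * id x).
  by apply: eq_gauss_mean => x; rewrite mulN1r.
by rewrite (gauss_meanZ (-1) gauss_integrable_id); lra.
Qed.

End gauss_odd.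

Section lindeberg.
Context {disp : measure_display} {T : measurableType disp} {R : realType}.
Variables (P : probability T R) (eps : nat -> {RV P >-> R}).
Hypothesis heps : iid_std_normal eps.
Variables (u : R -> R) (s b : R).
Hypotheses (iu : gauss_integrable u) (iu2 : gauss_integrable (fun y => u y ^+ 2)).
Hypothesis iu3 : gauss_integrable (fun y => `|u y| ^+ 3).
Hypotheses (u0 : gauss_mean u = 0) (s0 : 0 <= s).
Hypothesis us2 : gauss_mean (fun y => u y ^+ 2) = s ^+ 2.
Hypothesis ub : gauss_mean (fun y => `|u y| ^+ 3) <= b.
Variables (K B : R) (f f1 f2 : R -> R).
Hypotheses (mf : measurable_fun setT f) (mf1 : measurable_fun setT f1).
Hypotheses (mf2 : measurable_fun setT f2) (uf : unit_valued f).
Hypotheses (B1 : forall x, `|f1 x| <= B) (B2 : forall x, `|f2 x| <= B).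
Hypotheses (K0 : 0 <= K) (tf : taylor_bound K f f1 f2).

Local Notation gamma := (normal_prob (0 : R) 1).
(** Cost of one replacement: the third moment bound of the summand plus the third absolute moment of
    a centred Gaussian of deviation [s]. *)
Let err := K * (b + s ^+ 3 * gauss_absmom 3).
Let mu : measurable_fun setT u := gauss_integrable_measurable iu.

(* Replacing one summand by a centred Gaussian of the same variance. *)
Lemma lindeberg_step t x : 0 <= t ->
  gauss_mean (fun y => smooth t f (x + u y)) <=
  smooth (Num.sqrt (t ^+ 2 + s ^+ 2)) f x + err.
Proof.
move=> t0.
have tft := smooth_taylor_bound t mf mf1 mf2 uf B1 B2 tf.
have msf := measurable_smooth t mf uf.
have usf := smooth_unit_valued t mf uf.
have Hu := taylor_mean x msf usf tft K0 iu iu2 iu3 u0 us2 ub.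
have isy n : gauss_integrable (fun y => (s * y) ^+ n.+1).
  apply: (gauss_integrable_le _ _ (gauss_integrableZ (s ^+ n.+1)
    (gauss_integrable_norm_exp n.+1))).
  - by apply: measurable_funX; exact: measurable_funM.
  - by move=> y; rewrite normrX normrM exprMn (ger0_norm s0).
have isy3 : gauss_integrable (fun y => `|s * y| ^+ 3).
  apply: (gauss_integrable_le _ _ (gauss_integrableZ (s ^+ 3)
    (gauss_integrable_norm_exp 3))).
  - by apply: measurable_funX; apply: measurableT_comp => //; exact: measurable_funM.
  - by move=> y; rewrite ger0_norm ?exprn_ge0// normrM exprMn (ger0_norm s0).
have is1 : gauss_integrable (fun y => s * y) by exact: (isy 0).
have Hg : `|gauss_mean (fun y => smooth t f (x + s * y)) - smooth t f x
    - smooth t f2 x * s ^+ 2| <= K * (s ^+ 3 * gauss_absmom 3).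
  apply: (taylor_mean x msf usf tft K0 is1 (isy 1%N) isy3).
  - by rewrite (gauss_meanZ s gauss_integrable_id) gauss_mean_id mulr0.
  - under eq_gauss_mean do rewrite exprMn -[X in _ * X]real_normK ?num_real//.
    rewrite gauss_meanZ; last exact: gauss_integrable_norm_exp.
    by rewrite -[gauss_mean _]/(gauss_absmom 2) gauss_absmom2 mulr1.
  - under eq_gauss_mean do rewrite normrM exprMn (ger0_norm s0).
    by rewrite gauss_meanZ//; exact: gauss_integrable_norm_exp.
have E : gauss_mean (fun y => smooth t f (x + s * y)) =
    smooth (Num.sqrt (t ^+ 2 + s ^+ 2)) f x.
  by rewrite addrC -smooth_comp.
move: Hu Hg; rewrite E !ler_norml => /andP[_ Hu] /andP[Hg _].
by rewrite /err mulrDr; lra.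
Qed.

(** Each step peels off the last summand and moves its variance into the smoothing parameter. The
    parameter therefore grows along the induction, which is why [t] is arbitrary. *)
Lemma lindeberg n t : 0 <= t ->
  (\int[P]_w (smooth t f (partial_sum eps (fun=> u) n w))%:E <=
   (smooth (Num.sqrt (t ^+ 2 + n%:R * s ^+ 2)) f 0 + n%:R * err)%:E)%E.
Proof.
have mg : forall _ : nat, measurable_fun setT u by [].
elim: n t => [|n IHn] t t0.
  rewrite !mul0r !addr0 sqrtr_sqr ger0_norm//.
  rewrite (eq_integral (fun=> (smooth t f 0)%:E)); last first.
    by move=> w _; rewrite /partial_sum big_ord0.
  by rewrite integral_cst//= probability_setT mule1.
have msf := measurable_smooth t mf uf.
have usf := smooth_unit_valued t mf uf.
rewrite (integral_partial_sumS heps mg n (F := EFin \o smooth t f)) /=; last 2 first.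
- exact/measurable_EFinP.
- by move=> x; rewrite lee_fin; case/andP: (usf x).
set t' := Num.sqrt (t ^+ 2 + s ^+ 2).
have t'0 : 0 <= t' by exact: sqrtr_ge0.
have err0 : 0 <= err.
  rewrite mulr_ge0// addr_ge0//; last by rewrite mulr_ge0 ?exprn_ge0 ?gauss_absmom_ge0.
  by apply: le_trans ub; apply: Rintegral_ge0 => x _; rewrite exprn_ge0.
apply: (@le_trans _ _ (\int[P]_w ((smooth t' f (partial_sum eps (fun=> u) n w))%:E + err%:E)%E)%E).
  apply: ge0_le_integral => //.
  - move=> w _; apply: integral_ge0 => y _; rewrite lee_fin.
    by case/andP: (usf (partial_sum eps (fun=> u) n w + u y)).
  - pose G x := (\int[gamma]_y (smooth t f (x + u y))%:E)%E.
    apply: (@measurableT_comp _ _ _ _ _ _ G); last exact: measurable_partial_sum.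
    apply: (@measurable_fun_fubini_tonelli_F _ _ _ _ _ gamma
      (fun z : R * R => (smooth t f (z.1 + u z.2))%:E)) => /=.
      apply/measurable_EFinP; apply: (measurableT_comp msf).
      by apply: measurable_funD => //; exact: measurableT_comp.
    by move=> z; rewrite lee_fin; case/andP: (usf (z.1 + u z.2)).
  - apply: emeasurable_funD => //; apply/measurable_EFinP.
    apply: (measurableT_comp (measurable_smooth t' mf uf)).
    exact: measurable_partial_sum.
  - move=> w _; rewrite -gauss_meanE ?lee_fin; first exact: lindeberg_step.
    exact: unit_valued_integrable.
rewrite ge0_integralD//; last 2 first.
- move=> w _; rewrite lee_fin.
  by case/andP: (smooth_unit_valued t' mf uf (partial_sum eps (fun=> u) n w)).
- apply/measurable_EFinP; apply: measurableT_comp; first exact: measurable_smooth.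
  exact: measurable_partial_sum.
rewrite integral_cst//= probability_setT mule1.
apply: (le_trans (leeD (IHn t' t'0) (lexx _))).
rewrite -EFinD lee_fin /t' sqr_sqrtr ?addr_ge0 ?sqr_ge0//.
have -> : t ^+ 2 + s ^+ 2 + n%:R * s ^+ 2 = t ^+ 2 + n.+1%:R * s ^+ 2.
  by rewrite -[n.+1%:R]natr1; ring.
by rewrite -[n.+1%:R]natr1; lra.
Qed.

End lindeberg.

(** * Upper tails of power sums *)

Section spline.
Context {R : realType}.
Implicit Types x y a : R.

Definition pospart x : R := Num.max x 0.

Lemma measurable_pospart : measurable_fun setT pospart.
Proof. by apply: measurable_maxr. Qed.

(** The third derivative of the truncated cube lies between 0 and 6 away from the origin, so the
    remainder constant is [6 / 3! = 1]. The proof goes by the signs of [x] and [x + y]. *)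
Lemma pospart_cube_taylor x y :
  `|pospart (x + y) ^+ 3 - pospart x ^+ 3 - 3 * pospart x ^+ 2 * y
    - 3 * pospart x * y ^+ 2| <= `|y| ^+ 3.
Proof.
rewrite /pospart; have [x0|x0] := leP x 0; have [xy|xy] := leP (x + y) 0.
- by rewrite !expr0n/= !(mulr0, mul0r, subr0) normr0 exprn_ge0.
- rewrite !expr0n/= !(mulr0, mul0r, subr0) !ger0_norm ?exprn_ge0//; [|lra..].
  by apply: lerXn2r; rewrite ?nnegrE; lra.
- rewrite (ltr0_norm (_ : y < 0)); last lra.
  rewrite !expr0n/=; set w := - (x + y).
  have -> : 0 - x ^+ 3 - 3 * x ^+ 2 * y - 3 * x * y ^+ 2 = w ^+ 3 - (x + w) ^+ 3.
    by rewrite /w; ring.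
  have -> : - y = x + w by rewrite /w; ring.
  have w0 : 0 <= w by rewrite /w; lra.
  have : w ^+ 3 <= (x + w) ^+ 3 by apply: lerXn2r; rewrite ?nnegrE; lra.
  have : 0 <= w ^+ 3 by rewrite exprn_ge0.
  by rewrite ler_norml; lra.
- have -> : (x + y) ^+ 3 - x ^+ 3 - 3 * x ^+ 2 * y - 3 * x * y ^+ 2 = y ^+ 3 by ring.
  by rewrite normrX.
Qed.

(* The cdf of a sum of three independent uniform variables, as a C^2 cutoff. *)
Definition cutoff x : R :=
  (pospart x ^+ 3 - 3 * pospart (x - 1) ^+ 3 + 3 * pospart (x - 2) ^+ 3
   - pospart (x - 3) ^+ 3) / 6.
Definition cutoff1 x : R :=
  (pospart x ^+ 2 - 3 * pospart (x - 1) ^+ 2 + 3 * pospart (x - 2) ^+ 2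
   - pospart (x - 3) ^+ 2) / 2.
Definition cutoff2 x : R :=
  (pospart x - 3 * pospart (x - 1) + 3 * pospart (x - 2)
   - pospart (x - 3)) / 2.

Let mpos c n : measurable_fun setT (fun x => pospart (x - c) ^+ n).
Proof.
apply: measurable_funX; apply: (measurableT_comp measurable_pospart).
exact: measurable_funB.
Qed.

Let mpos0 n : measurable_fun setT (fun x => pospart x ^+ n).
Proof. by apply: measurable_funX; exact: measurable_pospart. Qed.

Let mcomb n : measurable_fun setT (fun x => pospart x ^+ n
  - 3 * pospart (x - 1) ^+ n + 3 * pospart (x - 2) ^+ n - pospart (x - 3) ^+ n).
Proof.
apply: measurable_funB; last exact: mpos.
apply: measurable_funD; last by apply: measurable_funM => //; exact: mpos.
by apply: measurable_funB; [exact: mpos0|apply: measurable_funM => //; exact: mpos].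
Qed.

Lemma measurable_cutoff : measurable_fun setT cutoff.
Proof. by apply: measurable_funM => //; exact: (mcomb 3). Qed.
Lemma measurable_cutoff1 : measurable_fun setT cutoff1.
Proof. by apply: measurable_funM => //; exact: (mcomb 2). Qed.
Lemma measurable_cutoff2 : measurable_fun setT cutoff2.
Proof. by apply: measurable_funM => //; exact: (mcomb 1). Qed.

(** The remainders of the four truncated cubes add up with weights [(1 + 3 + 3 + 1) / 6 = 4 / 3]. *)
Lemma cutoff_taylor : taylor_bound (4 / 3) cutoff cutoff1 cutoff2.
Proof.
move=> x y.
pose D z := pospart (z + y) ^+ 3 - pospart z ^+ 3 - 3 * pospart z ^+ 2 * y
    - 3 * pospart z * y ^+ 2.
have -> : cutoff (x + y) - cutoff x - cutoff1 x * y - cutoff2 x * y ^+ 2 =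
    (D x - 3 * D (x - 1) + 3 * D (x - 2) - D (x - 3)) / 6.
  rewrite /cutoff /cutoff1 /cutoff2 /D.
  rewrite (addrAC x y (- 1)) (addrAC x y (- 2)) (addrAC x y (- 3)).
  by field.
have H z : `|D z| <= `|y| ^+ 3 by exact: pospart_cube_taylor.
have := H x; have := H (x - 1); have := H (x - 2); have := H (x - 3).
by rewrite !ler_norml; lra.
Qed.

Let pos_pos x : 0 <= x -> pospart x = x.
Proof. by move=> x0; rewrite /pospart max_l. Qed.
Let pos_neg x : x <= 0 -> pospart x = 0.
Proof. by move=> x0; rewrite /pospart max_r. Qed.

Lemma cutoff_le0 x : x <= 0 -> cutoff x = 0.
Proof.
by move=> x0; rewrite /cutoff !pos_neg ?(expr0n, mulr0, addr0, subr0)/=; lra.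
Qed.

Lemma cutoff_ge3 x : 3 <= x -> cutoff x = 1.
Proof.
by move=> x0; rewrite /cutoff !pos_pos; [field|lra..].
Qed.

Lemma cutoff_bounds x : [/\ 0 <= cutoff x <= 1, `|cutoff1 x| <= 1 & `|cutoff2 x| <= 1].
Proof.
rewrite /cutoff /cutoff1 /cutoff2 !ler_norml.
have [x0|x0] := leP x 0.
  by rewrite !(@pos_neg x) ?(@pos_neg (x - 1)) ?(@pos_neg (x - 2)) ?(@pos_neg (x - 3))
    ?(expr0n, mulr0, addr0, subr0)/=; [split; lra|lra..].
have [x1|x1] := leP x 1.
  by rewrite !(@pos_pos x) ?(@pos_neg (x - 1)) ?(@pos_neg (x - 2)) ?(@pos_neg (x - 3))
    ?(expr0n, mulr0, addr0, subr0)/=; [split; nra|lra..].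
have [x2|x2] := leP x 2.
  rewrite !(@pos_pos x) ?(@pos_pos (x - 1)) ?(@pos_neg (x - 2)) ?(@pos_neg (x - 3))
    ?(expr0n, mulr0, addr0, subr0)/=; [|lra..].
  set t := x - 1; have -> : x = 1 + t by rewrite /t; ring.
  have t0 : 0 <= t by rewrite /t; lra.
  have t1 : 0 <= 1 - t by rewrite /t; lra.
  have h1 : 0 <= t * (1 - t) by exact: mulr_ge0.
  have h2 : 0 <= t ^+ 2 * (1 - t) by rewrite mulr_ge0// sqr_ge0.
  have h3 : 0 <= t ^+ 3 by rewrite exprn_ge0.
  by split; nra.
have [x3|x3] := leP x 3.
  rewrite !(@pos_pos x) ?(@pos_pos (x - 1)) ?(@pos_pos (x - 2)) ?(@pos_neg (x - 3))
    ?(expr0n, mulr0, addr0, subr0)/=; [|lra..].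
  set t := 3 - x; have -> : x = 3 - t by rewrite /t; ring.
  have t0 : 0 <= t by rewrite /t; lra.
  have t1 : 0 <= 1 - t by rewrite /t; lra.
  have h1 : 0 <= t * (1 - t) by exact: mulr_ge0.
  have h2 : 0 <= t ^+ 2 * (1 - t) by rewrite mulr_ge0// sqr_ge0.
  have h3 : 0 <= t ^+ 3 by rewrite exprn_ge0.
  by split; nra.
rewrite !(@pos_pos x) ?(@pos_pos (x - 1)) ?(@pos_pos (x - 2)) ?(@pos_pos (x - 3)); [|lra..].
by split; nra.
Qed.

Lemma taylor_bound_affine K f f1 f2 a c : 0 <= a -> taylor_bound K f f1 f2 ->
  taylor_bound (K * a ^+ 3) (fun x => f (a * x + c)) (fun x => a * f1 (a * x + c))
    (fun x => a ^+ 2 * f2 (a * x + c)).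
Proof.
move=> a0 tf x y; have := tf (a * x + c) (a * y).
have -> : K * a ^+ 3 * `|y| ^+ 3 = K * `|a * y| ^+ 3.
  by rewrite normrM exprMn (ger0_norm a0); ring.
apply: le_trans; rewrite le_eqVlt; apply/orP; left; apply/eqP; congr `|_|.
have -> : a * (x + y) + c = a * x + c + a * y by ring.
by ring.
Qed.

End spline.

Section gauss_tail.
Context {R : realType}.
Local Notation gamma := (normal_prob (0 : R) 1).
Local Notation mu := (@lebesgue_measure R).
Local Notation phi := (normal_pdf (0 : R) 1).
Implicit Types a b s x y : R.

Lemma std_normal_pdf_le x y : 0 <= x -> x <= y -> phi y <= phi x.
Proof.
move=> x0 xy; rewrite !std_normal_pdfE ler_wpM2l ?normal_peak_ge0// ler_expR; nra.
Qed.

Lemma std_normal_pdf_shift x y : phi (x + y) = phi x * expR (- (x * y + y ^+ 2 / 2)).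
Proof.
by rewrite !std_normal_pdfE -[RHS]mulrA -expRD; congr (_ * expR _); field.
Qed.

Lemma gauss_itv_ub a b : 0 <= a -> a <= b -> (gamma `[a, b[ <= ((b - a) * phi a)%:E)%E.
Proof.
move=> a0 ab; rewrite /normal_prob.
apply: (@le_trans _ _ (\int[mu]_(x in `[a, b[) (phi a)%:E)%E).
  apply: ge0_le_integral => //.
  - by move=> x _; rewrite lee_fin normal_pdf_ge0.
  - by apply/measurable_EFinP/measurable_funTS; exact: measurable_normal_pdf.
  - by move=> x; rewrite /= in_itv/= => /andP[ax _]; rewrite lee_fin std_normal_pdf_le.
rewrite integral_cst//= lebesgue_measure_itv/= lte_fin.
case: ltP => [_|_]; first by rewrite -EFinB -EFinM mulrC.
by rewrite mule0 lee_fin mulr_ge0 ?subr_ge0 ?normal_pdf_ge0.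
Qed.

Lemma gauss_itv_lb a b : 0 <= a -> a <= b -> (((b - a) * phi b)%:E <= gamma `[a, b])%E.
Proof.
move=> a0 ab; rewrite /normal_prob.
apply: (@le_trans _ _ (\int[mu]_(x in `[a, b]) (phi b)%:E)%E); last first.
  apply: ge0_le_integral => //.
  - by move=> x _; rewrite lee_fin normal_pdf_ge0.
  - by apply/measurable_EFinP/measurable_funTS; exact: measurable_normal_pdf.
  - move=> x; rewrite /= in_itv/= => /andP[ax xb].
    by rewrite lee_fin std_normal_pdf_le// (le_trans a0).
rewrite integral_cst//= lebesgue_measure_itv/= lte_fin.
case: ltP => [_|ba]; first by rewrite -EFinB -EFinM mulrC.
by rewrite (_ : b - a = 0) ?mul0r ?mule0//; lra.
Qed.

Lemma std_normal_cdfN s : (std_normal_cdf (- s))%:E = gamma `[s, +oo[.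
Proof.
rewrite /std_normal_cdf fineK ?fin_num_measure//.
have E (A : set R) : measurable A -> gamma A = (\int[gamma]_x (\1_A x)%:E)%E.
  by move=> mA; rewrite integral_indic// setIT.
rewrite E// [RHS]E//.
rewrite -(@ge0_integral_gaussN _ (fun x => (\1_`]-oo, (- s)] x)%:E))//; last first.
  exact/measurable_EFinP/measurable_indic.
apply: eq_integral => x _; congr EFin; rewrite !indicE; congr (nat_of_bool _)%:R.
by apply/idP/idP; rewrite !inE/= !in_itv/= andbT lerN2.
Qed.

(** The mass of [[s - 3/s, s[] is at most [3/s] times the density at its left end, while the tail
    beyond [s] contains [[s, s + 1/s]], of mass at least [1/s] times the density at its right end.
    The two densities differ by a bounded factor. *)
Lemma gauss_tail_shift s : 3 <= s ->
  (gamma `[(s - 3 / s)%R, +oo[ <= ((1 + 3 * expR 5) * std_normal_cdf (- s))%:E)%E.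
Proof.
move=> s3; have s0 : 0 < s by lra.
have s1 : 3 / s <= 1 by rewrite ler_pdivrMr// mul1r.
have s1' : 0 < 3 / s by rewrite divr_gt0.
have s2 : 0 < s^-1 by rewrite invr_gt0.
rewrite (_ : `[_, +oo[%classic = `[(s - 3 / s)%R, s[ `|` `[s, +oo[); last first.
  by rewrite -itv_bndbnd_setU// bnd_simp; lra.
apply: (le_trans (measureU2 _ _ _)) => //.
rewrite [X in (_ + X)%E](_ : _ = (std_normal_cdf (- s))%:E); last first.
  exact/esym/std_normal_cdfN.
have -> : (1 + 3 * expR 5) * std_normal_cdf (- s) =
    std_normal_cdf (- s) + 3 * expR 5 * std_normal_cdf (- s) by ring.
rewrite [leRHS]EFinD [leLHS]addeC; apply: leeD2l.
have sE : s * (3 / s) = 3 by field; lra.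
have sE' : s * s^-1 = 1 by rewrite mulfV//; lra.
have ub := @gauss_itv_ub (s - 3 / s) s ltac:(lra) ltac:(lra).
have lb := @gauss_itv_lb s (s + s^-1) ltac:(lra) ltac:(lra).
have lb' : (s + s^-1 - s) * phi (s + s^-1) <= std_normal_cdf (- s).
  rewrite -lee_fin (le_trans lb)// std_normal_cdfN le_measure ?inE//.
  by move=> x /=; rewrite !in_itv/= andbT => /andP[].
apply: (le_trans ub); rewrite lee_fin.
apply: (@le_trans _ _ (3 * expR 5 * ((s + s^-1 - s) * phi (s + s^-1)))); last first.
  by rewrite ler_wpM2l// mulr_ge0// expR_ge0.
rewrite !std_normal_pdf_shift.
have -> : s - (s - 3 / s) = 3 * s^-1 by ring.
have -> : s + s^-1 - s = s^-1 by ring.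
rewrite [leRHS](_ : _ = 3 * s^-1 *
  (phi s * (expR 5 * expR (- (s * s^-1 + s^-1 ^+ 2 / 2))))); last by ring.
rewrite ler_wpM2l//; first by rewrite mulr_ge0// ltW.
(* The left exponent is at most 3 and the right one at least [5 - 1 - 1/18], since [s >= 3]; hence
   the generous [expR 5]. *)
rewrite ler_wpM2l ?normal_pdf_ge0// -expRD ler_expR mulrN sE sE'.
nra.
Qed.

End gauss_tail.

Section centered_power.
Context {R : realType}.

Lemma measurable_norm_exp n : measurable_fun setT (fun x : R => `|x| ^+ n).
Proof. exact: measurable_funX. Qed.

Lemma centered_sqrE n (x : R) : (`|x| ^+ n - gauss_absmom n) ^+ 2 =
  `|x| ^+ (2 * n) - 2 * gauss_absmom n * `|x| ^+ n + gauss_absmom n ^+ 2.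
Proof. by rewrite mulnC exprM; ring. Qed.

Lemma gauss_integrable_sqr_centered n :
  gauss_integrable (fun x : R => (`|x| ^+ n - gauss_absmom n) ^+ 2).
Proof.
have i k := @gauss_integrable_norm_exp R k.
under eq_fun do rewrite centered_sqrE.
apply: gauss_integrableD; last exact: gauss_integrable_cst.
by apply: gauss_integrableB => //; exact: gauss_integrableZ.
Qed.

Lemma gauss_mean_sqr_centered n :
  gauss_mean (fun x : R => (`|x| ^+ n - gauss_absmom n) ^+ 2) = gauss_var n.
Proof.
have i k := @gauss_integrable_norm_exp R k.
have iZ := gauss_integrableZ (2 * gauss_absmom n) (i n).
rewrite (eq_gauss_mean (centered_sqrE n)).
rewrite (gauss_meanD (gauss_integrableB (i _) iZ) (gauss_integrable_cst _)).
rewrite (gauss_meanB (i _) iZ) gauss_meanZ// gauss_mean_cst.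
by rewrite -/(gauss_absmom n) -/(gauss_absmom (2 * n)) /gauss_var; ring.
Qed.

End centered_power.

Section std_normal_expectation.
Context {disp : measure_display} {T : measurableType disp} {R : realType}.
Variables (P : probability T R) (eps : nat -> {RV P >-> R}).
Hypothesis heps : iid_std_normal eps.

Lemma ge0_integral_eps i (f : R -> \bar R) : measurable_fun setT f ->
  (forall x, 0 <= f x)%E ->
  (\int[P]_w f (eps i w) = \int[normal_prob (0 : R)%R 1%R]_x f x)%E.
Proof.
move=> mf f0; have [_ law] := heps.
by rewrite -(ge0_integral_std_normal (law i) mf f0) ge0_integral_distribution.
Qed.

Lemma abs_momentE i j : abs_moment (eps i) j%:R = gauss_absmom j.
Proof.
rewrite /abs_moment unlock.
under eq_integral do rewrite powR_mulrn//.
rewrite (@ge0_integral_eps i (fun x => (`|x| ^+ j)%:E))//.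
by apply/measurable_EFinP; exact: measurable_norm_exp.
Qed.

Lemma abs_varianceE i j : abs_variance (eps i) j%:R = gauss_var j.
Proof.
rewrite /abs_variance /variance covariance.unlock expectation.unlock.
rewrite -gauss_mean_sqr_centered /gauss_mean /Rintegral; congr fine.
rewrite -(@ge0_integral_eps i (fun x => ((`|x| ^+ j - gauss_absmom j) ^+ 2)%:E)).
- apply: eq_integral => w _; rewrite -(abs_momentE i j) /abs_moment expr2.
  by rewrite expectation.unlock /= -powR_mulrn.
- apply/measurable_EFinP; apply: measurable_funX; apply: measurable_funB => //.
  exact: measurable_norm_exp.
- by move=> x; rewrite lee_fin sqr_ge0.
Qed.

End std_normal_expectation.

Section power_sum_tail.
Context {disp : measure_display} {T : measurableType disp} {R : realType}.
Variables (P : probability T R) (eps : nat -> {RV P >-> R}).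
Hypothesis heps : iid_std_normal eps.
Variables (j d : nat).
Hypotheses (j0 : (0 < j)%N) (d0 : (0 < d)%N).

Local Notation gamma := (normal_prob (0 : R) 1).
Let s : R := (Num.sqrt d%:R)^-1.
Let sigma : R := Num.sqrt (gauss_var j).
(** Standardised so that [d] summands have total variance 1 and the Gaussian comparison law is
    [gamma] itself. *)
Let u (y : R) := s / sigma * (`|y| ^+ j - gauss_absmom j).
(** This is [(3/2)^(3/2)], the growth factor of the rate condition. *)
Let q : R := Num.sqrt (27 / 8).

Let dR0 : 0 < d%:R :> R. Proof. by rewrite ltr0n. Qed.
Let s_gt0 : 0 < s. Proof. by rewrite invr_gt0 sqrtr_gt0. Qed.
Let s_sqr : s ^+ 2 = d%:R^-1.
Proof. by rewrite exprVn sqr_sqrtr// ltW. Qed.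
Let sigma_gt0 : 0 < sigma. Proof. by rewrite sqrtr_gt0 gauss_var_gt0. Qed.
Let sigma_sqr : sigma ^+ 2 = gauss_var j.
Proof. by rewrite sqr_sqrtr// ltW// gauss_var_gt0. Qed.

Let iu : gauss_integrable u.
Proof.
apply: gauss_integrableZ; apply: gauss_integrableB.
  exact: gauss_integrable_norm_exp.
exact: gauss_integrable_cst.
Qed.

Let u_sqr y : u y ^+ 2 = (s / sigma) ^+ 2 * (`|y| ^+ j - gauss_absmom j) ^+ 2.
Proof. by rewrite exprMn. Qed.

Let iu2 : gauss_integrable (fun y => u y ^+ 2).
Proof.
rewrite (_ : (fun _ => _) = (fun y => (s / sigma) ^+ 2 * (`|y| ^+ j - gauss_absmom j) ^+ 2)).
  by apply: gauss_integrableZ; exact: gauss_integrable_sqr_centered.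
by apply/funext => y; exact: u_sqr.
Qed.

Let us2 : gauss_mean (fun y => u y ^+ 2) = s ^+ 2.
Proof.
rewrite (eq_gauss_mean u_sqr) gauss_meanZ; last exact: gauss_integrable_sqr_centered.
by rewrite gauss_mean_sqr_centered -sigma_sqr -[LHS]exprMn divfK// gt_eqF.
Qed.

Let ss_ge0 : 0 <= s / sigma. Proof. by rewrite divr_ge0// ltW. Qed.

Let u0 : gauss_mean u = 0.
Proof.
rewrite /u gauss_meanZ; last first.
  apply: gauss_integrableB; first exact: gauss_integrable_norm_exp.
  exact: gauss_integrable_cst.
rewrite gauss_meanB; [|exact: gauss_integrable_norm_exp|exact: gauss_integrable_cst].
by rewrite gauss_mean_cst subrr mulr0.
Qed.

Let u_cube y : `|u y| ^+ 3 <=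
  (s / sigma) ^+ 3 * (`|y| ^+ (3 * j) + gauss_absmom j ^+ 3).
Proof.
rewrite /u normrM exprMn (ger0_norm ss_ge0).
rewrite ler_wpM2l ?exprn_ge0// mulnC exprM.
set t := _ ^+ j; set m := gauss_absmom j.
have t0 : 0 <= t by rewrite exprn_ge0.
have m0 : 0 <= m by exact: gauss_absmom_ge0.
have [tm|tm] := leP m t.
  rewrite ger0_norm ?subr_ge0//; apply: (@le_trans _ _ (t ^+ 3)).
    by apply: lerXn2r; rewrite ?nnegrE; lra.
  by rewrite lerDl exprn_ge0.
rewrite ltr0_norm ?subr_lt0//; apply: (@le_trans _ _ (m ^+ 3)).
  by apply: lerXn2r; rewrite ?nnegrE; lra.
by rewrite lerDr exprn_ge0.
Qed.

Let icube : gauss_integrable (fun y : R =>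
  (s / sigma) ^+ 3 * (`|y| ^+ (3 * j) + gauss_absmom j ^+ 3)).
Proof.
apply: gauss_integrableZ; apply: gauss_integrableD.
  exact: gauss_integrable_norm_exp.
exact: gauss_integrable_cst.
Qed.

Let iu3 : gauss_integrable (fun y => `|u y| ^+ 3).
Proof.
apply: (gauss_integrable_le _ _ icube).
  apply: measurable_funX; apply: measurableT_comp => //.
  exact: gauss_integrable_measurable.
move=> y; rewrite [leLHS]ger0_norm; last by rewrite exprn_ge0.
exact: u_cube.
Qed.

(** After squaring, this is [gauss_absmom3_sqr_le] with the second moment replaced by [4 sigma^2]
    through [gauss_var_ge]; the 8 comes from [8^2 = 4^3]. *)
Let lyapunov_ratio : gauss_absmom (3 * j) <= 8 * q ^+ j * sigma ^+ 3.
Proof.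
have q0 : 0 <= q by exact: sqrtr_ge0.
rewrite -(@ler_pXn2r _ 2)// ?nnegrE ?gauss_absmom_ge0//; last first.
  by rewrite !mulr_ge0 ?exprn_ge0// ltW.
apply: (le_trans (gauss_absmom3_sqr_le _)).
have qj : (q ^+ j) ^+ 2 = (27 / 8) ^+ j by rewrite exprAC sqr_sqrtr// divr_ge0.
have sg : (sigma ^+ 3) ^+ 2 = gauss_var j ^+ 3 by rewrite exprAC sigma_sqr.
have -> (A B : R) : (8 * A * B) ^+ 2 = A ^+ 2 * (8 ^+ 2 * B ^+ 2) by ring.
rewrite qj sg ler_wpM2l ?exprn_ge0 ?divr_ge0//.
have := gauss_var_ge (R := R) j0.
set m := gauss_absmom _ => mv.
have m0 : 0 <= m by exact: gauss_absmom_ge0.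
have -> : 8 ^+ 2 * gauss_var j ^+ 3 = (4 * gauss_var j) ^+ 3 :> R by ring.
by apply: lerXn2r; rewrite ?nnegrE; lra.
Qed.

(** In [u_cube] both the moment of order [3 * j] and the cubed mean are at most [8 q^j sigma^3],
    whence 16. *)
Let ub : gauss_mean (fun y => `|u y| ^+ 3) <= 16 * q ^+ j * s ^+ 3.
Proof.
apply: (le_trans (le_gauss_mean iu3 icube u_cube)).
rewrite gauss_meanZ; last first.
  apply: gauss_integrableD; first exact: gauss_integrable_norm_exp.
  exact: gauss_integrable_cst.
rewrite gauss_meanD; [|exact: gauss_integrable_norm_exp|exact: gauss_integrable_cst].
rewrite gauss_mean_cst -/(gauss_absmom (3 * j)).
have := lyapunov_ratio; have := @gauss_absmom_cube_le R j.
set m := gauss_absmom (3 * j); set m1 := _ ^+ 3 => m1m mq.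
have E : (s / sigma) ^+ 3 * sigma ^+ 3 = s ^+ 3.
  by rewrite -[LHS]exprMn divfK// gt_eqF.
rewrite -E mulrCA ler_wpM2l ?exprn_ge0//; lra.
Qed.

(* The cutoff rescaled to rise from 0 at a - 3/a to 1 at a: this width costs only a constant
   factor in the Gaussian tail, and a factor a^3 in the replacement error. *)
Lemma power_sum_tail (a : R) : 3 <= a ->
  (P [set w | (a * Num.sqrt (d%:R * gauss_var j) + d%:R * gauss_absmom j <=
     \sum_(i < d) `|eps i w| ^+ j)%R] <=
   ((1 + 3 * expR 5) * std_normal_cdf (- a) + 24 * a ^+ 3 * q ^+ j / Num.sqrt d%:R)%:E)%E.
Proof.
move=> a3.
pose f (x : R) := cutoff (a * x + (3 - a ^+ 2)).
pose f1 (x : R) := a * cutoff1 (a * x + (3 - a ^+ 2)).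
pose f2 (x : R) := a ^+ 2 * cutoff2 (a * x + (3 - a ^+ 2)).
have maff : measurable_fun setT (fun x : R => a * x + (3 - a ^+ 2)).
  by apply: measurable_funD => //; exact: measurable_funM.
have mf : measurable_fun setT f by exact: (measurableT_comp measurable_cutoff maff).
have mf1 : measurable_fun setT f1.
  by apply: measurable_funM => //; exact: (measurableT_comp measurable_cutoff1 maff).
have mf2 : measurable_fun setT f2.
  by apply: measurable_funM => //; exact: (measurableT_comp measurable_cutoff2 maff).
have uf : unit_valued f by move=> x; have [] := cutoff_bounds (a * x + (3 - a ^+ 2)).
have B1 x : `|f1 x| <= a ^+ 2.
  rewrite normrM ger0_norm; last lra.
  have [_ + _] := cutoff_bounds (a * x + (3 - a ^+ 2)); nra.
have B2 x : `|f2 x| <= a ^+ 2.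
  rewrite normrM ger0_norm ?sqr_ge0// ler_piMr ?sqr_ge0//.
  by have [] := cutoff_bounds (a * x + (3 - a ^+ 2)).
have a0 : 0 <= a by lra.
have tf : taylor_bound (4 / 3 * a ^+ 3) f f1 f2.
  by apply: taylor_bound_affine => //; exact: cutoff_taylor.
have K0 : 0 <= 4 / 3 * a ^+ 3 by rewrite mulr_ge0// ?exprn_ge0// divr_ge0.
have mu := gauss_integrable_measurable iu.
(* Started at [t = 0], that is, with no smoothing on the left; on the right [d * s^2 = 1] leaves a
   standard normal. *)
have := lindeberg heps iu iu2 iu3 u0 (ltW s_gt0) us2 ub mf mf1 mf2 uf B1 B2 K0 tf d (lexx 0).
rewrite smooth0 expr0n/= add0r s_sqr mulfV ?gt_eqF// sqrtr1 => L.
have msum := measurable_partial_sum eps (fun=> mu) d.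
have E : [set w | a * Num.sqrt (d%:R * gauss_var j) + d%:R * gauss_absmom j <=
     \sum_(i < d) `|eps i w| ^+ j] = [set w | a <= partial_sum eps (fun=> u) d w].
  have SE w : partial_sum eps (fun=> u) d w =
      s / sigma * (\sum_(i < d) `|eps i w| ^+ j - d%:R * gauss_absmom j).
    rewrite /partial_sum /u -mulr_sumr sumrB; congr (_ * (_ - _)).
    by rewrite sumr_const card_ord mulr_natl.
  have dv : Num.sqrt (d%:R * gauss_var j) = (s / sigma)^-1.
    by rewrite sqrtrM ?ler0n// invf_div /s invrK mulrC.
  apply/seteqP; split => w /=; rewrite SE dv -lerBrDr ler_pdivrMr ?divr_gt0// mulrC; exact: id.
rewrite E.
apply: (@le_trans _ _ (\int[P]_w (f (partial_sum eps (fun=> u) d w))%:E)%E).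
  have mE : measurable [set w | a <= partial_sum eps (fun=> u) d w].
    rewrite -[X in measurable X]setTI.
    by apply: (measurable_fun_le measurableT) => //.
  rewrite -[leLHS]mul1e -[leLHS](@integral_cst _ _ _ P _ mE).
  rewrite integral_mkcond; apply: ge0_le_integral => //.
  - by move=> w _; rewrite patchE; case: ifP => // _; rewrite lee_fin.
  - by apply/(measurable_restrictT _ _).1.
  - by apply/measurable_EFinP; apply: (measurableT_comp mf).
  - move=> w _; rewrite patchE; case: ifPn => [|_]; last first.
      by rewrite lee_fin; case/andP: (uf (partial_sum eps (fun=> u) d w)).
    rewrite inE/= => aw; rewrite lee_fin /f cutoff_ge3//; nra.
apply: (le_trans L); rewrite lee_fin; apply: lerD.
  rewrite -lee_fin; apply: le_trans (gauss_tail_shift a3).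
  rewrite smoothE// /gauss_smooth.
  set I := `[_, +oo[%classic.
  have mI : measurable I by exact: measurable_itv.
  rewrite -[leRHS]mul1e -[leRHS](@integral_cst _ _ _ gamma _ mI).
  rewrite [leRHS]integral_mkcond; apply: ge0_le_integral => //.
  - by move=> y _; rewrite lee_fin; case/andP: (uf (0 + 1 * y)).
  - by apply/measurable_EFinP; exact: measurable_shift.
  - by apply/(measurable_restrictT _ _).1.
  - move=> y _; rewrite patchE add0r mul1r; case: ifPn => [_|].
      by rewrite lee_fin; case/andP: (uf y).
    rewrite notin_setE /I /= in_itv/= andbT => /negP; rewrite -ltNge => ya.
    rewrite lee_fin /f cutoff_le0//.
    have aE : a * (3 / a) = 3 by field; lra.
    have : a * y <= a * (a - 3 / a) by rewrite ler_wpM2l// ltW.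
    by rewrite mulrBr aE; lra.
rewrite -/s.
have s3 : d%:R * s ^+ 3 = s by rewrite exprS s_sqr mulrCA mulfV ?mulr1 ?gt_eqF.
have m3 : gauss_absmom 3 <= 2 :> R.
  have := @gauss_absmom1_sqr_le R; rewrite gauss_absmom3; nra.
have q1 : 1 <= q ^+ j.
  rewrite exprn_ege1// -[leLHS]sqrtr1 ler_sqrt; lra.
have -> : d%:R * (4 / 3 * a ^+ 3 * (16 * q ^+ j * s ^+ 3 + s ^+ 3 * gauss_absmom 3)) =
  4 / 3 * a ^+ 3 * (16 * q ^+ j + gauss_absmom 3) * (d%:R * s ^+ 3) by ring.
rewrite s3 ler_wpM2r ?(ltW s_gt0)//.
(* 18 collects the 16 of [ub] and the Gaussian third moment, at most 2, absorbed by [q^j >= 1]. *)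
have -> : 24 * a ^+ 3 * q ^+ j = 4 / 3 * a ^+ 3 * (18 * q ^+ j) by field.
by rewrite ler_wpM2l//; lra.
Qed.

End power_sum_tail.

(** * Lower tails of shifted power sums *)

Section second_moment.
Context {disp : measure_display} {T : measurableType disp} {R : realType}.
Variables (P : probability T R) (eps : nat -> {RV P >-> R}).
Hypothesis heps : iid_std_normal eps.
Variables (c : nat -> R -> R) (v : nat -> R).
Hypotheses (ic : forall i, gauss_integrable (c i)).
Hypotheses (ic2 : forall i, gauss_integrable (fun y => c i y ^+ 2)).
Hypotheses (c0 : forall i, gauss_mean (c i) = 0).
Hypotheses (cv : forall i, gauss_mean (fun y => c i y ^+ 2) <= v i).
Let mc i : measurable_fun setT (c i) := gauss_integrable_measurable (ic i).

(** The summands are centred, so the cross term vanishes when the last one is integrated out. *)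
Lemma partial_sum_second_moment n :
  (\int[P]_w (partial_sum eps c n w ^+ 2)%:E <= (\sum_(i < n) v i)%:E)%E.
Proof.
elim: n => [|n IHn].
  rewrite big_ord0 (eq_integral (fun=> 0%E)) ?integral0//.
  by move=> w _; rewrite /partial_sum big_ord0 expr0n.
rewrite big_ord_recr/= (integral_partial_sumS heps mc n (F := fun x => (x ^+ 2)%:E)).
- have v0 : 0 <= v n.
    by apply: le_trans (cv n); apply: Rintegral_ge0 => x _; exact: sqr_ge0.
  apply: (@le_trans _ _ (\int[P]_w ((partial_sum eps c n w ^+ 2)%:E + (v n)%:E))%E); last first.
    rewrite ge0_integralD//.
    + by rewrite integral_cst//= probability_setT mule1 EFinD leeD2r.
    + by move=> w _; rewrite lee_fin sqr_ge0.
    + apply/measurable_EFinP; apply: measurable_funX; exact: measurable_partial_sum.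
  apply: ge0_le_integral => //.
  + by move=> w _; apply: integral_ge0 => y _; rewrite lee_fin sqr_ge0.
  + pose G x := (\int[normal_prob (0 : R)%R 1%R]_y ((x + c n y) ^+ 2)%:E)%E.
    apply: (@measurableT_comp _ _ _ _ _ _ G); last exact: measurable_partial_sum.
    apply: (@measurable_fun_fubini_tonelli_F _ _ _ _ _ (normal_prob (0 : R) 1)
      (fun z : R * R => ((z.1 + c n z.2) ^+ 2)%:E)) => /=.
      apply/measurable_EFinP; apply: measurable_funX.
      by apply: measurable_funD => //; exact: measurableT_comp.
    by move=> z; rewrite lee_fin sqr_ge0.
  + apply: emeasurable_funD => //; apply/measurable_EFinP; apply: measurable_funX.
    exact: measurable_partial_sum.
  + move=> w _; set x := partial_sum eps c n w.
    have E y : (x + c n y) ^+ 2 = x ^+ 2 + 2 * x * c n y + c n y ^+ 2 by ring.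
    under eq_integral do rewrite E.
    have i1 : gauss_integrable (fun y => x ^+ 2 + 2 * x * c n y).
      by apply: gauss_integrableD; [exact: gauss_integrable_cst|exact: gauss_integrableZ].
    rewrite -gauss_meanE; last exact: gauss_integrableD.
    rewrite gauss_meanD// gauss_meanD; [|exact: gauss_integrable_cst|exact: gauss_integrableZ].
    by rewrite gauss_meanZ// c0 mulr0 addr0 gauss_mean_cst lee_fin lerD2l.
- by apply/measurable_EFinP; exact: measurable_funX.
- by move=> x; rewrite lee_fin sqr_ge0.
Qed.

Lemma partial_sum_lower_tail n (t : R) : 0 < t ->
  (P [set w | (partial_sum eps c n w <= - t)%R] <=
   ((\sum_(i < n) v i) / t ^+ 2)%:E)%E.
Proof.
move=> t0.
have mS := measurable_partial_sum eps mc n.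
set E := [set w | _].
have mE : measurable E.
  rewrite -[X in measurable X]setTI.
  exact: (measurable_fun_le measurableT).
have H : ((t ^+ 2)%:E * P E <= \int[P]_w (partial_sum eps c n w ^+ 2)%:E)%E.
  rewrite -[leLHS](@integral_cst _ _ _ P _ mE) [leLHS]integral_mkcond.
  apply: ge0_le_integral => //.
  - by move=> w _; rewrite patchE; case: ifP => // _; rewrite lee_fin sqr_ge0.
  - by apply/(measurable_restrictT _ _).1.
  - by apply/measurable_EFinP; exact: measurable_funX.
  - move=> w _; rewrite patchE; case: ifPn => [|_]; last by rewrite lee_fin sqr_ge0.
    by rewrite inE /E/= => H; rewrite lee_fin; nra.
rewrite mulrC EFinM lee_pdivlMl ?exprn_gt0//.
exact: (le_trans H (partial_sum_second_moment n)).
Qed.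

End second_moment.

Section shifted_power.
Context {R : realType}.
Implicit Types t x y : R.

Lemma exprD_le (k : nat) x y : 0 <= x -> 0 <= y ->
  (x + y) ^+ k <= 2 ^+ k * (x ^+ k + y ^+ k).
Proof.
move=> x0 y0; have [xy|yx] := leP x y.
  apply: (@le_trans _ _ ((2 * y) ^+ k)).
    by apply: lerXn2r; rewrite ?nnegrE; lra.
  by rewrite exprMn ler_wpM2l ?exprn_ge0// lerDr exprn_ge0.
apply: (@le_trans _ _ ((2 * x) ^+ k)).
  by apply: lerXn2r; rewrite ?nnegrE; lra.
by rewrite exprMn ler_wpM2l ?exprn_ge0// lerDl exprn_ge0.
Qed.

Lemma gauss_integrable_shift_exp t (k : nat) : gauss_integrable (fun y => (t + y) ^+ k).
Proof.
apply: (@gauss_integrable_le _ _ (fun y => 2 ^+ k * (`|t| ^+ k + `|y| ^+ k))).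
- by apply: measurable_funX; exact: measurable_funD.
- move=> y; rewrite normrX; apply: le_trans (exprD_le k (normr_ge0 t) (normr_ge0 y)).
  by apply: lerXn2r; rewrite ?nnegrE// ?addr_ge0// ler_normD.
- apply: gauss_integrableZ; apply: gauss_integrableD.
    exact: gauss_integrable_cst.
  exact: gauss_integrable_norm_exp.
Qed.

(** Midpoint convexity by induction, each step being Chebyshev's sum inequality for [x, y] and their
    powers. *)
Lemma mean_exp_ge (m : nat) x y : 0 <= x -> 0 <= y ->
  ((x + y) / 2) ^+ m.+1 <= (x ^+ m.+1 + y ^+ m.+1) / 2.
Proof.
move=> x0 y0; elim: m => [|m IH]; first by rewrite !expr1.
rewrite exprS; apply: (@le_trans _ _ ((x + y) / 2 * ((x ^+ m.+1 + y ^+ m.+1) / 2))).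
  by rewrite ler_wpM2l// divr_ge0// addr_ge0.
have H : 0 <= (x - y) * (x ^+ m.+1 - y ^+ m.+1).
  have [xy|yx] := leP x y.
    rewrite -mulrNN mulr_ge0//; first lra.
    by rewrite opprB subr_ge0; apply: lerXn2r; rewrite ?nnegrE.
  rewrite mulr_ge0//; first lra.
  by rewrite subr_ge0; apply: lerXn2r; rewrite ?nnegrE// ltW.
rewrite [x ^+ m.+2]exprS [y ^+ m.+2]exprS.
move: H; set a := x ^+ _; set b := y ^+ _; nra.
Qed.

(** Of the mixed binomial terms only one copy of [x^(m+1) y] is kept; it is the source of the
    quadratic part of the energy. *)
Lemma exprD_ge (m : nat) x y : 0 <= x -> 0 <= y ->
  x ^+ m.+2 + y ^+ m.+2 + x ^+ m.+1 * y <= (x + y) ^+ m.+2.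
Proof.
move=> x0 y0; elim: m => [|m IH]; first by nra.
rewrite [leRHS]exprS; apply: (le_trans _ (ler_wpM2l (addr_ge0 x0 y0) IH)).
rewrite ![_ ^+ m.+3]exprS.
have h1 : 0 <= x ^+ m.+2 by rewrite exprn_ge0.
have h2 : 0 <= y ^+ m.+2 by rewrite exprn_ge0.
have h3 : 0 <= x ^+ m.+1 by rewrite exprn_ge0.
have h4 : 0 <= x ^+ m.+1 * y * y by rewrite !mulr_ge0.
have h5 : x ^+ m.+2 = x * x ^+ m.+1 by rewrite exprS.
have h6 := mulr_ge0 x0 h2.
have h7 := mulr_ge0 y0 h1.
have h8 := mulr_ge0 x0 (mulr_ge0 h3 y0).
nra.
Qed.

(** Convexity at the points [(t + y)^2] and [(t - y)^2], whose midpoint is [y^2 + t^2], followed by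
    [exprD_ge]. *)
Lemma symmetrized_power_ge (m : nat) t y :
  y ^+ (2 * m.+2) + t ^+ (2 * m.+2) + y ^+ (2 * m.+1) * t ^+ 2 <=
  ((t + y) ^+ (2 * m.+2) + (t - y) ^+ (2 * m.+2)) / 2.
Proof.
rewrite !exprM.
apply: (le_trans (exprD_ge m (sqr_ge0 y) (sqr_ge0 t))).
apply: le_trans (mean_exp_ge m.+1 (sqr_ge0 (t + y)) (sqr_ge0 (t - y))).
have -> : y ^+ 2 + t ^+ 2 = ((t + y) ^+ 2 + (t - y) ^+ 2) / 2 by field.
by [].
Qed.

Lemma gauss_absmom_even_ge1 (m : nat) : 1 <= gauss_absmom (2 * m) :> R.
Proof.
elim: m => [|m IH]; first by rewrite muln0 gauss_absmom0.
rewrite (_ : 2 * m.+1 = (2 * m).+2)%N; last by lia.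
by rewrite gauss_absmomSS mulr_ege1// ler1n.
Qed.

Lemma even_norm_exp (m : nat) y : `|y| ^+ (2 * m) = y ^+ (2 * m).
Proof. by rewrite !exprM real_normK ?num_real. Qed.

(** By symmetry of the noise the integrand may be symmetrised. The term in [t^2] keeps coefficient 1
    because even Gaussian moments are at least 1. *)
Lemma gauss_mean_shift_exp_ge (m : nat) t : (1 < m)%N ->
  gauss_absmom (2 * m) + (t ^+ 2 + t ^+ (2 * m)) <=
  gauss_mean (fun y => (t + y) ^+ (2 * m)).
Proof.
case: m => [//|[//|m]] _.
have i k := @gauss_integrable_norm_exp R k.
have is0 := gauss_integrable_shift_exp t (2 * m.+2).
have is1 := gauss_integrableN is0.
have sym : gauss_mean (fun y => (t + y) ^+ (2 * m.+2)) =
   gauss_mean (fun y => 2^-1 * ((t + y) ^+ (2 * m.+2) + (t + - y) ^+ (2 * m.+2))).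
  rewrite (gauss_meanZ _ (gauss_integrableD is0 is1)) (gauss_meanD is0 is1).
  by rewrite (gauss_meanN is0); field.
have i3 : gauss_integrable (fun y => `|y| ^+ (2 * m.+2) + t ^+ (2 * m.+2)).
  by apply: gauss_integrableD => //; exact: gauss_integrable_cst.
have i4 := gauss_integrableZ (t ^+ 2) (i (2 * m.+1)%N).
apply: (@le_trans _ _ (gauss_mean (fun y => `|y| ^+ (2 * m.+2) + t ^+ (2 * m.+2) +
    t ^+ 2 * `|y| ^+ (2 * m.+1)))).
  rewrite (gauss_meanD i3 i4) gauss_meanD//; last exact: gauss_integrable_cst.
  rewrite gauss_mean_cst gauss_meanZ// -!/(gauss_absmom _).
  have := gauss_absmom_even_ge1 m.+1; have := sqr_ge0 t; nra.
rewrite sym; apply: le_gauss_mean.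
- exact: gauss_integrableD.
- by apply: gauss_integrableZ; exact: gauss_integrableD.
- move=> y; rewrite !even_norm_exp (mulrC 2^-1) (mulrC (t ^+ 2)).
  exact: symmetrized_power_ge.
Qed.

(** Variance constant for the exponent [k.+1]: the squared mean value factor, the crude bound
    [exprD_le] with exponent [2 * k], and the remaining Gaussian moments. *)
Definition power_var_cst (k : nat) : R :=
  k.+1%:R ^+ 2 * 2 ^+ (2 * k) * (1 + gauss_absmom (2 * k).+2).

Lemma power_var_cst_gt0 k : 0 < power_var_cst k.
Proof.
by rewrite !mulr_gt0 ?exprn_gt0 ?ltr0n// addr_gt0// gauss_absmom_gt0.
Qed.

Lemma shift_exp_dev (k : nat) t y : `|(t + y) ^+ k.+1 - t ^+ k.+1| <=
  k.+1%:R * `|y| * (`|t| + `|y|) ^+ k.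
Proof.
rewrite subrXX (_ : t + y - t = y); last by ring.
rewrite normrM -[leRHS]mulrA [leRHS]mulrCA ler_wpM2l//.
apply: (le_trans (ler_norm_sum _ _ _)).
rewrite mulr_natl -[in leRHS](card_ord k.+1) -sumr_const.
apply: ler_sum => i _; rewrite normrM !normrX.
rewrite -[in leRHS](subnK (ltnSE (ltn_ord i))) exprD.
apply: ler_pM; rewrite ?exprn_ge0//.
  by apply: lerXn2r; rewrite ?nnegrE ?addr_ge0// ler_normD.
by apply: lerXn2r; rewrite ?nnegrE ?addr_ge0// lerDl.
Qed.

Lemma shift_exp_var_integrable (k : nat) t e :
  gauss_integrable (fun y => ((t + y) ^+ k - e) ^+ 2).
Proof.
have E y : ((t + y) ^+ k - e) ^+ 2 = (t + y) ^+ (2 * k) - 2 * e * (t + y) ^+ k + e ^+ 2.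
  by rewrite mulnC exprM; ring.
under eq_fun do rewrite E.
apply: gauss_integrableD; last exact: gauss_integrable_cst.
apply: gauss_integrableB; first exact: gauss_integrable_shift_exp.
by apply: gauss_integrableZ; exact: gauss_integrable_shift_exp.
Qed.

(** Allows the variance of a shifted power to be estimated around the noiseless value instead of its
    mean. *)
Lemma gauss_mean_var_le (f : R -> R) e : gauss_integrable f ->
  (forall e', gauss_integrable (fun y => (f y - e') ^+ 2)) ->
  gauss_mean (fun y => (f y - gauss_mean f) ^+ 2) <= gauss_mean (fun y => (f y - e) ^+ 2).
Proof.
move=> fi fi2; set m := gauss_mean f.
have E : gauss_mean (fun y => (f y - e) ^+ 2) =
    gauss_mean (fun y => (f y - m) ^+ 2 + (2 * (m - e) * (f y - m) + (m - e) ^+ 2)).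
  by apply: eq_gauss_mean => y; ring.
have i1 : gauss_integrable (fun y => f y - m).
  by apply: gauss_integrableB => //; exact: gauss_integrable_cst.
have i2 := gauss_integrableZ (2 * (m - e)) i1.
have i3 := gauss_integrableD i2 (gauss_integrable_cst ((m - e) ^+ 2)).
rewrite E (gauss_meanD (fi2 m) i3) (gauss_meanD i2 (gauss_integrable_cst _)).
rewrite (gauss_meanZ _ i1) (gauss_meanB fi (gauss_integrable_cst _)) !gauss_mean_cst.
by rewrite -/m subrr mulr0 add0r lerDl sqr_ge0.
Qed.

(** The growth in [t] is two orders below the square of [t^(k+1)]; this gap makes Chebyshev's
    inequality effective for large shifts. *)
Lemma gauss_mean_shift_exp_var (k : nat) t :
  gauss_mean (fun y =>
    ((t + y) ^+ k.+1 - gauss_mean (fun z => (t + z) ^+ k.+1)) ^+ 2) <=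
  power_var_cst k * (1 + `|t| ^+ (2 * k)).
Proof.
have H := gauss_mean_var_le (t ^+ k.+1) (gauss_integrable_shift_exp t k.+1)
  (shift_exp_var_integrable k.+1 t).
apply: (le_trans H).
have i l := @gauss_integrable_norm_exp R l.
set c := k.+1%:R ^+ 2 * 2 ^+ (2 * k) : R.
have c0 : 0 <= c by rewrite mulr_ge0// exprn_ge0// ler0n.
have i1 := gauss_integrableZ (`|t| ^+ (2 * k)) (i 2%N).
have i2 := gauss_integrableD i1 (i (2 * k).+2).
apply: (@le_trans _ _ (gauss_mean (fun y =>
    c * (`|t| ^+ (2 * k) * `|y| ^+ 2 + `|y| ^+ (2 * k).+2)))).
  apply: le_gauss_mean; first exact: shift_exp_var_integrable.
    exact: gauss_integrableZ.
  move=> y; rewrite -real_normK ?num_real//.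
  apply: (@le_trans _ _ ((k.+1%:R * `|y| * (`|t| + `|y|) ^+ k) ^+ 2)).
    by apply: lerXn2r; rewrite ?nnegrE ?mulr_ge0 ?exprn_ge0 ?addr_ge0//; exact: shift_exp_dev.
  have -> : (k.+1%:R * `|y| * (`|t| + `|y|) ^+ k) ^+ 2 =
      k.+1%:R ^+ 2 * (`|y| ^+ 2 * (`|t| + `|y|) ^+ (2 * k)) :> R.
    by rewrite (mulnC 2) exprM; ring.
  rewrite /c -[leRHS]mulrA ler_wpM2l ?sqr_ge0//.
  have D := exprD_le (2 * k) (normr_ge0 t) (normr_ge0 y).
  apply: (le_trans (ler_wpM2l (sqr_ge0 _) D)).
  rewrite (_ : (2 * k).+2 = 2 + 2 * k)%N // (exprD `|y|).
  by rewrite le_eqVlt; apply/orP; left; apply/eqP; ring.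
rewrite (gauss_meanZ _ i2) (gauss_meanD i1 (i _)) (gauss_meanZ _ (i _)).
rewrite -!/(gauss_absmom _) gauss_absmom2 mulr1 /power_var_cst -/c -mulrA ler_wpM2l//.
have m0 := @gauss_absmom_ge0 R (2 * k).+2.
have t0 : 0 <= `|t| ^+ (2 * k) by rewrite exprn_ge0.
nra.
Qed.

End shifted_power.

Section power_sum_lower.
Context {disp : measure_display} {T : measurableType disp} {R : realType}.
Variables (P : probability T R) (eps : nat -> {RV P >-> R}).
Hypothesis heps : iid_std_normal eps.
Variables (m d : nat) (th : 'I_d -> R) (L r : R).
Hypotheses (m2 : (1 < m)%N) (L0 : 0 < L).

Let A : R := \sum_(i < d) (th i ^+ 2 + th i ^+ (2 * m)).
Hypotheses (A0 : 0 < A) (rA : 2 * (r * Num.sqrt (d%:R * gauss_var (2 * m))) <= A).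

(** The power splits as [(2m - 2) + 2m]. Where [|th_i| <= L] the first factor is at most [L^(2m-2)];
    elsewhere it is at most [th_i^(2m) / L^2 <= A / L^2]. *)
Lemma sum_power_le : \sum_(i < d) `|th i| ^+ (2 * (2 * m).-1) <=
  A ^+ 2 / L ^+ 2 + L ^+ (2 * m).-2 * A.
Proof.
pose a i : R := th i ^+ (2 * m).
have a0 i : 0 <= a i by rewrite /a -even_norm_exp exprn_ge0.
have aA i : a i <= A.
  rewrite /A (bigD1 i)//= -[leLHS]addr0 lerD ?lerDr ?sqr_ge0//.
  by apply: sumr_ge0 => k _; rewrite addr_ge0 ?sqr_ge0//; exact: a0.
have sa : \sum_(i < d) a i <= A by apply: ler_sum => i _; rewrite lerDr sqr_ge0.
apply: (@le_trans _ _ (\sum_(i < d) (A / L ^+ 2 + L ^+ (2 * m).-2) * a i)); last first.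
  rewrite -mulr_sumr; apply: (@le_trans _ _ ((A / L ^+ 2 + L ^+ (2 * m).-2) * A)).
    rewrite ler_wpM2l// addr_ge0 ?exprn_ge0 ?(ltW L0)// divr_ge0 ?exprn_ge0 ?(ltW L0)//.
    exact: ltW.
  by rewrite le_eqVlt; apply/orP; left; apply/eqP; ring.
apply: ler_sum => i _.
have -> : (2 * (2 * m).-1 = (2 * m).-2 + 2 * m)%N by lia.
rewrite exprD even_norm_exp; apply: ler_wpM2r; first exact: a0.
have [tL|Lt] := leP `|th i| L.
  apply: (@le_trans _ _ (L ^+ (2 * m).-2)).
    by apply: lerXn2r; rewrite ?nnegrE// ltW.
  by rewrite lerDr divr_ge0 ?exprn_ge0 ?(ltW L0)// ltW.
apply: (@le_trans _ _ (A / L ^+ 2)); last by rewrite lerDl exprn_ge0// ltW.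
rewrite ler_pdivlMr ?exprn_gt0//; apply: le_trans (aA i).
rewrite /a -even_norm_exp (_ : 2 * m = (2 * m).-2 + 2)%N; last by lia.
rewrite exprD addn2 ler_wpM2l ?exprn_ge0//.
by apply: lerXn2r; rewrite ?nnegrE// ltW.
Qed.

(** The mean exceeds its null value by at least [A], and by [rA] the threshold uses up at most
    [A / 2]. Staying below it forces a deviation of [A / 2], whose square gives the factor 4. *)
Lemma power_sum_lower :
  (P [set w | (\sum_(i < d) `|th i + eps i w| ^+ (2 * m) <
     r * Num.sqrt (d%:R * gauss_var (2 * m)) + d%:R * gauss_absmom (2 * m))%R] <=
   (4 * power_var_cst (2 * m).-1 *
     (d%:R / A ^+ 2 + (L ^+ 2)^-1 + L ^+ (2 * m).-2 / A))%:E)%E.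
Proof.
(* Families for [partial_sum] are indexed by all naturals; the shift is extended by 0 beyond [d]. *)
pose t (i : nat) : R := oapp th 0 (insub i).
have tE (i : 'I_d) : t i = th i by rewrite /t valK.
pose e i := gauss_mean (fun y => (t i + y) ^+ (2 * m)).
pose c i y := (t i + y) ^+ (2 * m) - e i.
pose v i := power_var_cst (2 * m).-1 * (1 + `|t i| ^+ (2 * (2 * m).-1)).
have mS : (2 * m = (2 * m).-1.+1)%N by lia.
have ic i : gauss_integrable (c i).
  apply: gauss_integrableB; first exact: gauss_integrable_shift_exp.
  exact: gauss_integrable_cst.
have ic2 i : gauss_integrable (fun y => c i y ^+ 2) by exact: shift_exp_var_integrable.
have c0 i : gauss_mean (c i) = 0.
  rewrite /c (gauss_meanB (gauss_integrable_shift_exp _ _) (gauss_integrable_cst _)).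
  by rewrite gauss_mean_cst subrr.
have cv i : gauss_mean (fun y => c i y ^+ 2) <= v i.
  rewrite /c /v /e {1 2}mS; exact: gauss_mean_shift_exp_var.
have mc i := gauss_integrable_measurable (ic i).
have A20 : 0 < A / 2 by rewrite divr_gt0.
have := partial_sum_lower_tail heps ic ic2 c0 cv d A20.
have sub : [set w | (\sum_(i < d) `|th i + eps i w| ^+ (2 * m) <
     r * Num.sqrt (d%:R * gauss_var (2 * m)) + d%:R * gauss_absmom (2 * m))%R] `<=`
    [set w | partial_sum eps c d w <= - (A / 2)].
  move=> w /= H.
  have -> : partial_sum eps c d w =
      \sum_(i < d) `|th i + eps i w| ^+ (2 * m) - \sum_(i < d) e i.
    rewrite /partial_sum /c sumrB; congr (_ - _).
    by apply: eq_bigr => i _; rewrite tE even_norm_exp.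
  have : A + d%:R * gauss_absmom (2 * m) <= \sum_(i < d) e i.
    have -> : d%:R * gauss_absmom (2 * m) = \sum_(i < d) gauss_absmom (2 * m) :> R.
      by rewrite sumr_const card_ord mulr_natl.
    rewrite /A -big_split/=; apply: ler_sum => i _.
    by rewrite /e tE addrC; exact: gauss_mean_shift_exp_ge.
  by move: H rA; lra.
move=> H; apply: (le_trans _ (le_trans H _)).
  rewrite le_measure ?inE//.
  - set b := _ + _; rewrite (_ : [set w | _] =
        ~` [set w | b <= \sum_(i < d) `|th i + eps i w| ^+ (2 * m)]); last first.
      by apply/seteqP; split => w /=; rewrite ltNge => /negP.
    apply: measurableC; rewrite -[X in measurable X]setTI.
    apply: (measurable_fun_le measurableT) => //.
    apply: measurable_sum => i; apply: measurable_funX; apply: measurableT_comp => //.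
    exact: measurable_funD.
  - rewrite -[X in measurable X]setTI; apply: (measurable_fun_le measurableT) => //.
    exact: measurable_partial_sum.
rewrite lee_fin; have S := sum_power_le.
have C0 := @power_var_cst_gt0 R (2 * m).-1.
have -> : \sum_(i < d) v i = power_var_cst (2 * m).-1 *
    (d%:R + \sum_(i < d) `|th i| ^+ (2 * (2 * m).-1)).
  rewrite /v -mulr_sumr big_split/= sumr_const card_ord; congr (_ * (_ + _)).
  by apply: eq_bigr => i _; rewrite tE.
rewrite ler_pdivrMr ?exprn_gt0//.
set C := power_var_cst _ in C0 *.
have -> : 4 * C * (d%:R / A ^+ 2 + (L ^+ 2)^-1 + L ^+ (2 * m).-2 / A) * (A / 2) ^+ 2 =
   C * (d%:R + (A ^+ 2 / L ^+ 2 + L ^+ (2 * m).-2 * A)).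
  by field; rewrite !gt_eqF ?exprn_gt0.
by rewrite ler_wpM2l ?(ltW C0)// lerD2l.
Qed.

End power_sum_lower.

(** * The maximum test *)

Section powR_facts.
Context {R : realType}.
Implicit Types (x s q rho : R).

(** The tangent at 1 of a concave power, obtained from Young's inequality with second factor 1 and
    exponents [1/s] and [1/(1-s)]. *)
Lemma powR_le_affine x s : 0 <= x -> 0 < s <= 1 -> x `^ s <= s * x + (1 - s).
Proof.
move=> x0 /andP[s0]; rewrite le_eqVlt => /predU1P[->|s1].
  by rewrite powRr1//; lra.
have sn : s != 0 by rewrite gt_eqF.
have s1n : 1 - s != 0 by rewrite gt_eqF//; lra.
have := @conjugate_powR R (x `^ s) 1 s^-1 (1 - s)^-1 (powR_ge0 _ _) ler01.
rewrite !invr_gt0 s0 (_ : 0 < 1 - s); last lra.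
rewrite !invrK mulr1 powR1 -powRrM mulfV// powRr1// => /(_ isT isT).
by rewrite mul1r (mulrC x); apply; ring.
Qed.

Lemma ger_powR_exp2 x q (n : nat) : 0 <= x -> 2 <= q -> q <= n%:R ->
  x `^ q <= x ^+ 2 + x ^+ n.
Proof.
move=> x0 q2 qn; have [x1|x1] := leP 1 x.
  rewrite -[x ^+ n]powR_mulrn//; apply: (@le_trans _ _ (x `^ n%:R)); first exact: ler_powR.
  by rewrite lerDr sqr_ge0.
have [->|xn0] := eqVneq x 0.
  by rewrite powR0 ?addr_ge0 ?exprn_ge0//; apply/eqP; lra.
rewrite -[x ^+ 2]powR_mulrn//; apply: (@le_trans _ _ (x `^ 2%:R)).
  by apply: ger_powR => //; rewrite lt_def xn0 x0/= ltW.
by rewrite lerDl exprn_ge0.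
Qed.

Lemma powR_le_iff x y s : 0 <= x -> 0 <= y -> 0 < s -> (x `^ s <= y `^ s) = (x <= y).
Proof.
move=> x0 y0 s0; apply/idP/idP; last first.
  by move=> xy; apply: ge0_ler_powR; rewrite ?nnegrE// ltW.
by apply: contraTT; rewrite -!ltNge => yx; apply: gt0_ltr_powR.
Qed.

Variable d : nat.
Hypothesis d0 : (0 < d)%N.
Let dR0 : 0 < d%:R :> R. Proof. by rewrite ltr0n. Qed.

Lemma crit_radius_gt0 q : 0 < crit_radius q d.
Proof. by rewrite /crit_radius; case: ifP => _; rewrite powR_gt0. Qed.

Lemma lqnorm_ge q rho (x : 'rV[R]_d) : 0 < q -> 0 <= rho ->
  (rho <= lqnorm q x) = (rho `^ q <= \sum_(i < d) `|x ord0 i| `^ q).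
Proof.
move=> q0 rho0; rewrite /lqnorm.
have S0 : 0 <= \sum_(i < d) `|x ord0 i| `^ q by apply: sumr_ge0 => i _; exact: powR_ge0.
rewrite -[LHS](@powR_le_iff _ _ q) ?powR_ge0// -powRrM mulVf ?gt_eqF// powRr1//.
Qed.

(* For q <= 2 this is the comparison of l^q and l^2 norms, obtained by averaging the
   tangent inequality a^(q/2) <= (q/2) a + 1 - q/2 at the points a = th_i^2 / c. *)
Lemma alternative_energy q rho (m : nat) (x : 'rV[R]_d) : 0 < q ->
  q <= (2 * m)%:R -> 1 <= rho -> rho * crit_radius q d <= lqnorm q x ->
  rho ^+ 2 * Num.sqrt d%:R <= \sum_(i < d) (x ord0 i ^+ 2 + x ord0 i ^+ (2 * m)).
Proof.
move=> q0 qn rho1.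
have rho0 : 0 < rho by lra.
have qn0 : q != 0 by rewrite gt_eqF.
have sd0 : 0 < Num.sqrt d%:R :> R by rewrite sqrtr_gt0.
have sd2 : Num.sqrt d%:R ^+ 2 = d%:R :> R by rewrite sqr_sqrtr// ltW.
rewrite lqnorm_ge//; last by rewrite mulr_ge0 ?(ltW rho0)// ltW ?crit_radius_gt0.
rewrite powRM ?(ltW rho0) ?(ltW (crit_radius_gt0 q))// /crit_radius.
case: ifPn => [q2|]; last first.
  rewrite -ltNge => q2; rewrite -powRrM invfM mulfVK// powR12_sqrt ?ler0n// => H.
  apply: (@le_trans _ _ (rho `^ q * Num.sqrt d%:R)).
    rewrite ler_wpM2r ?(ltW sd0)// -powR_mulrn ?(ltW rho0)//.
    by apply: ler_powR => //; exact: ltW.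
  apply: (le_trans H); apply: ler_sum => i _.
  rewrite -[x ord0 i ^+ 2]real_normK ?num_real// -even_norm_exp.
  by apply: ger_powR_exp2 => //; exact: ltW.
(* The squared coordinate of the constant vector whose [q]-norm is exactly [rho * crit_radius q d],
   the extremal case. *)
set c := rho ^+ 2 / Num.sqrt d%:R.
have c0 : 0 < c by rewrite divr_gt0// exprn_gt0.
set w := c `^ (q / 2).
have w0 : 0 < w by rewrite powR_gt0.
have -> : rho `^ q * (d%:R `^ ((4 - q) / (4 * q))) `^ q = w * d%:R.
  rewrite /w /c powRM ?invr_ge0 ?exprn_ge0 ?(ltW rho0) ?(ltW sd0)//.
  have -> : (rho ^+ 2) `^ (q / 2) = rho `^ q.
    by rewrite -powR_mulrn ?(ltW rho0)// -powRrM; congr (_ `^ _); field.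
  rewrite -mulrA; congr (_ * _).
  have -> : (Num.sqrt d%:R)^-1 = d%:R `^ (- 2^-1) :> R.
    by rewrite powRN powR12_sqrt ?ler0n.
  rewrite -!powRrM.
  transitivity (d%:R `^ (- 2^-1 * (q / 2) + 1) : R); first by congr (_ `^ _); field.
  by rewrite powRD ?powRr1 ?ler0n// (gt_eqF dR0) implybT.
have bnd i : `|x ord0 i| `^ q <= w * (q / 2 * (x ord0 i ^+ 2 / c) + (1 - q / 2)).
  have -> : `|x ord0 i| `^ q = w * (x ord0 i ^+ 2 / c) `^ (q / 2).
    rewrite /w -powRM ?(ltW c0)//; last by rewrite divr_ge0 ?sqr_ge0// ltW.
    rewrite mulrCA mulfV ?gt_eqF// mulr1 -[x ord0 i ^+ 2]real_normK ?num_real//.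
    by rewrite -powR_mulrn// -powRrM; congr (_ `^ _); field.
  rewrite ler_wpM2l ?(ltW w0)//; apply: powR_le_affine.
    by rewrite divr_ge0 ?sqr_ge0// ltW.
  by apply/andP; split; lra.
move=> H; have {H} := le_trans H (ler_sum _ (fun i _ => bnd i)).
rewrite -mulr_sumr ler_pM2l// big_split/= -mulr_sumr -mulr_suml sumr_const card_ord.
rewrite -[in X in _ <= X](mulr_natr (1 - q / 2)).
set B := \sum_(i < d) x ord0 i ^+ 2 => H.
(* The summed tangents give [d <= q/2 * (B / c) + (1 - q/2) * d], and the factor [q/2] cancels. *)
have dc : d%:R <= B / c.
  have q20 : 0 < q / 2 by lra.
  by rewrite -(ler_pM2l q20); lra.
apply: (@le_trans _ _ B).
  have -> : rho ^+ 2 * Num.sqrt d%:R = d%:R * c.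
    rewrite /c -[X in _ = X * _]sd2; field; exact: lt0r_neq0.
  by rewrite -ler_pdivlMr.
rewrite big_split/= lerDl; apply: sumr_ge0 => i _.
by rewrite -even_norm_exp exprn_ge0.
Qed.

End powR_facts.

Section test_event.
Context {disp : measure_display} {T : measurableType disp} {R : realType}.
Variables (P : probability T R) (eps : nat -> {RV P >-> R}).
Hypothesis heps : iid_std_normal eps.
Variables (r : R -> nat -> R) (pd : nat -> nat) (d : nat).
Hypotheses (d0 : (0 < d)%N) (rho0 : 0 < rel_radius r d).

(** At [a = rel_radius r d] this is the [j]-th power of [kappa], which turns the comparison of norms
    into one of power sums. *)
Definition threshold (a : R) (j : nat) : R :=
  a * Num.sqrt (d%:R * gauss_var j) + d%:R * gauss_absmom j.

Definition power_event (a : R) (th : 'rV[R]_d) (j : nat) : set T :=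
  [set w | threshold a j <= \sum_(i < d) `|th ord0 i + eps i w| ^+ j].

Lemma measurable_power_event a th j : measurable (power_event a th j).
Proof.
rewrite -[X in measurable X]setTI; apply: (measurable_fun_le measurableT) => //.
apply: measurable_sum => i; apply: measurable_funX; apply: measurableT_comp => //.
exact: measurable_funD.
Qed.

Lemma threshold_gt0 j : (0 < j)%N -> 0 < threshold (rel_radius r d) j.
Proof.
move=> j0; rewrite addr_gt0// mulr_gt0// ?sqrtr_gt0 ?mulr_gt0 ?ltr0n//.
  exact: gauss_var_gt0.
exact: gauss_absmom_gt0.
Qed.

Lemma norm_test_event th w j : (0 < j)%N ->
  (1 <= (kappa eps r j d)^-1 * lqnorm j%:R (th + noise eps d w)) =
  (threshold (rel_radius r d) j <= \sum_(i < d) `|th ord0 i + eps i w| ^+ j).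
Proof.
move=> j0; have t0 := threshold_gt0 j0.
have kE : kappa eps r j d = threshold (rel_radius r d) j `^ j%:R^-1.
  by rewrite /kappa (abs_momentE heps) (abs_varianceE heps).
have k0 : 0 < kappa eps r j d by rewrite kE powR_gt0.
rewrite -ler_pdivrMl ?invr_gt0// invrK mulr1 lqnorm_ge ?ltr0n// ?(ltW k0)//.
rewrite kE -powRrM mulVf ?pnatr_eq0 -?lt0n// powRr1 ?(ltW t0)//.
congr (_ <= _); apply: eq_bigr => i _; rewrite !mxE powR_mulrn//.
Qed.

Lemma bigmax_ge1 (F : nat -> R) (p : nat) :
  1 <= \big[Num.max/0]_(1 <= j < p.+1) F j <->
  exists2 j, (0 < j <= p)%N & 1 <= F j.
Proof.
rewrite big_add1/= big_mkord; split.
  move=> H; apply: contrapT => nF; move: H; apply/negP; rewrite -ltNge.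
  apply/bigmax_ltP; split => // i _; rewrite ltNge; apply/negP => Fi.
  by apply: nF; exists i.+1; rewrite //= ltn_ord.
case=> j /andP[j0 jp] Fj.
have jp' : (j.-1 < p)%N by rewrite prednK.
apply: (@bigmax_sup _ _ _ _ (Ordinal jp')) => //=.
by rewrite prednK.
Qed.

Definition reject_event (a : R) (th : 'rV[R]_d) : set T :=
  \bigcup_(j in [set j | (0 < j <= pd d)%N]) power_event a th j.

Lemma measurable_reject_event a th : measurable (reject_event a th).
Proof. by apply: bigcup_measurable => j _; exact: measurable_power_event. Qed.

Lemma expectation_max_test th :
  ('E_P[fun w => max_test eps r pd (d := d) (th + noise eps d w)])%E =
  P (reject_event (rel_radius r d) th).
Proof.
rewrite expectation.unlock.
transitivity (\int[P]_w (\1_(reject_event (rel_radius r d) th) w)%:E)%E; last first.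
  by rewrite integral_indic ?setIT//; exact: measurable_reject_event.
apply: eq_integral => w _; rewrite /max_test !indicE; congr ((nat_of_bool _)%:R)%:E.
apply/idP/idP; rewrite !inE /=.
  move=> /bigmax_ge1[j jp]; rewrite norm_test_event; last by case/andP: jp.
  by move=> H; exists j.
case=> j /= jp H; apply/bigmax_ge1; exists j => //.
by rewrite norm_test_event//; case/andP: jp.
Qed.

Lemma reject_event_le a (b : nat -> R) :
  (forall j, (0 < j <= pd d)%N -> (P (power_event a 0 j) <= (b j)%:E)%E) ->
  (P (reject_event a 0) <= (\sum_(1 <= j < (pd d).+1) b j)%:E)%E.
Proof.
move=> Hb.
have -> : reject_event a 0 = \big[setU/set0]_(i < pd d) power_event a 0 i.+1.
  rewrite -(bigcup_mkord _ (fun i => power_event a 0 i.+1)); apply/seteqP; split => w [j /= jp wj].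
    by exists j.-1; rewrite /= prednK//; case/andP: jp.
  by exists j.+1.
apply: (@le_trans _ _ (\sum_(i < pd d) P (power_event a 0 i.+1))%E).
  by apply: (@Boole_inequality _ _ _ P (fun i => power_event a 0 i.+1)) => i _;
    exact: measurable_power_event.
rewrite big_add1/= big_mkord -sumEFin; apply: lee_sum => i _.
by apply: Hb; rewrite /= ltn_ord.
Qed.

End test_event.

Section tail_asymptotics.
Context {R : realType}.
Implicit Types (q t p : R).

(** The step [3 q^n + q^(n+1) <= 3 q^(n+1)] is exactly [3 <= 2 q]. *)
Lemma geometric_sum_le q (n : nat) : 3 / 2 <= q ->
  \sum_(1 <= j < n.+1) q ^+ j <= 3 * q ^+ n.
Proof.
move=> q32; elim: n => [|n IH].
  by rewrite big_geq// mulr_ge0// exprn_ge0//; lra.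
rewrite big_nat_recr//=; apply: (le_trans (lerD IH (lexx _))).
have qn : 0 <= q ^+ n by rewrite exprn_ge0//; lra.
rewrite exprS; nra.
Qed.

Lemma sqrt_exp_powR (n : nat) :
  Num.sqrt (27 / 8) ^+ n = (3 / 2) `^ (3 * n%:R / 2) :> R.
Proof.
rewrite -powR12_sqrt ?divr_ge0// (_ : 27 / 8 = (3 / 2) ^+ 3); last by field.
rewrite -[(3 / 2) ^+ 3]powR_mulrn ?divr_ge0// -[LHS]powR_mulrn ?powR_ge0// -!powRrM.
by congr (_ `^ _); field.
Qed.

Lemma std_normal_cdf_ge0 t : 0 <= std_normal_cdf t.
Proof. by rewrite fine_ge0. Qed.

(** Markov's inequality for the fourth moment. Any power above 3 would do: the capped level is
    [t = p_d^(1/3)], and [t^3] times the bound must vanish. *)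
Lemma std_normal_cdfN_le t : 0 < t -> std_normal_cdf (- t) <= 3 / t ^+ 4.
Proof.
move=> t0; rewrite ler_pdivlMr ?exprn_gt0// mulrC -lee_fin EFinM std_normal_cdfN.
set I := `[t, +oo[%classic.
have mI : measurable I by exact: measurable_itv.
have -> : 3 = gauss_absmom 4 :> R by rewrite gauss_absmom4.
rewrite gauss_absmomE /gauss_moment.
rewrite -[leLHS](@integral_cst _ _ _ (normal_prob (0 : R) 1) _ mI) [leLHS]integral_mkcond.
apply: ge0_le_integral => //.
- by move=> x _; rewrite patchE; case: ifP => // _; rewrite lee_fin exprn_ge0// ltW.
- by apply/(measurable_restrictT _ _).1.
- by apply/measurable_EFinP; exact: measurable_norm_exp.
- move=> x _; rewrite patchE; case: ifPn => [|_]; last by rewrite lee_fin exprn_ge0.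
  rewrite inE /I /= in_itv/= andbT => tx; rewrite lee_fin.
  by apply: lerXn2r; rewrite ?nnegrE ?(ltW t0)// (le_trans tx)// ler_norm.
Qed.

Lemma cvg_powR_pinfty (u : nat -> R) p : 0 < p ->
  u n @[n --> \oo] --> +oo -> (u n `^ p) @[n --> \oo] --> +oo.
Proof.
move=> p0 /cvgryPge uoo; apply/cvgryPge => A.
have := uoo (`|A| `^ p^-1); apply: filterS => n un.
apply: (le_trans (ler_norm A)).
have -> : `|A| = (`|A| `^ p^-1) `^ p by rewrite -powRrM mulVf ?gt_eqF// powRr1.
apply: ge0_ler_powR; rewrite ?nnegrE ?powR_ge0// ?(ltW p0)//.
by apply: le_trans un; exact: powR_ge0.
Qed.

Lemma cvg_inv_pinfty (u : nat -> R) :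
  u n @[n --> \oo] --> +oo -> ((u n)^-1) @[n --> \oo] --> 0.
Proof.
move=> uoo; apply/gtr0_cvgV0 => //.
by have /cvgryPgt := uoo; exact.
Qed.

End tail_asymptotics.

Section error_bounds.
Context {disp : measure_display} {T : measurableType disp} {R : realType}.
Variables (P : probability T R) (eps : nat -> {RV P >-> R}).
Hypothesis heps : iid_std_normal eps.
Variables (r : R -> nat -> R) (pd : nat -> nat) (d : nat).
Hypotheses (d0 : (0 < d)%N) (rho0 : 0 < rel_radius r d).

(* The normal approximation is applied at the capped level a = min(rel_radius, p_d^(1/3)),
   so that its error a^3 q^(p_d) / sqrt d is absorbed by the rate condition. *)
Lemma max_test_size_le : (0 < pd d)%N -> 3 <= rel_radius r d -> 3 <= (pd d)%:R `^ (3^-1) :> R ->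
  (P (reject_event eps pd (d := d) (rel_radius r d) 0) <=
   ((1 + 3 * expR 5) * ((pd d)%:R * std_normal_cdf (- rel_radius r d)
      + 3 * ((pd d)%:R `^ (3^-1))^-1)
    + 72 * ((pd d)%:R / Num.sqrt d%:R * (3 / 2) `^ (3 * (pd d)%:R / 2)))%:E)%E.
Proof.
move=> p0 rho3.
set rho := rel_radius r d in rho3 *; set p : R := (pd d)%:R.
set t := p `^ _ => t3.
have tp : t ^+ 3 = p by rewrite /t -powR_mulrn ?powR_ge0// -powRrM mulVf// powRr1// ler0n.
set a := Num.min rho t.
have a3 : 3 <= a by rewrite le_min rho3.
set C := 1 + 3 * expR 5; set q : R := Num.sqrt (27 / 8).
have C0 : 0 <= C by rewrite addr_ge0// mulr_ge0// expR_ge0.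
have b j : (0 < j <= pd d)%N -> (P (power_event eps (d := d) rho 0 j) <=
    (C * std_normal_cdf (- a) + 24 * a ^+ 3 / Num.sqrt d%:R * q ^+ j)%:E)%E.
  case/andP=> j0 _; rewrite mulrAC.
  apply: le_trans (power_sum_tail heps j0 d0 a3).
  rewrite le_measure ?inE//; [exact: measurable_power_event| |].
    rewrite -[X in measurable X]setTI; apply: (measurable_fun_le measurableT) => //.
    by apply: measurable_sum => i; apply: measurable_funX; exact: measurableT_comp.
  move=> w /=; rewrite /power_event /threshold /=.
  under eq_bigr do rewrite mxE add0r.
  apply: le_trans; rewrite lerD2r ler_wpM2r ?sqrtr_ge0//.
  by rewrite ge_min lexx.
apply: (le_trans (reject_event_le b)); rewrite lee_fin big_split/= sumr_const_nat subn1/=.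
rewrite -mulr_sumr; apply: lerD.
  rewrite -[leLHS]mulr_natr -/p -[leLHS]mulrA; apply: ler_wpM2l => //; rewrite mulrC.
  (* [a] equals [rho] or [t], so its tail is at most the sum of the two. *)
  apply: (@le_trans _ _ (p * (std_normal_cdf (- rho) + std_normal_cdf (- t)))).
    rewrite ler_wpM2l ?ler0n//; have := @std_normal_cdf_ge0 R (- rho).
    have := @std_normal_cdf_ge0 R (- t).
    by rewrite /a; case: (leP rho t) => _; lra.
  rewrite mulrDr lerD2l -tp.
  have t0 : 0 < t by lra.
  apply: (le_trans (ler_wpM2l _ (std_normal_cdfN_le t0))); first by rewrite exprn_ge0// ltW.
  by rewrite le_eqVlt; apply/orP; left; apply/eqP; field; exact: lt0r_neq0.
have q32 : 3 / 2 <= q.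
  rewrite -[leLHS]ger0_norm ?divr_ge0// -sqrtr_sqr ler_sqrt ?divr_ge0//; lra.
have sd0 : 0 < (Num.sqrt d%:R)^-1 :> R by rewrite invr_gt0 sqrtr_gt0 ltr0n.
have a0 : 0 <= a by lra.
apply: (@le_trans _ _ (24 * a ^+ 3 / Num.sqrt d%:R * (3 * q ^+ pd d))).
  rewrite ler_wpM2l ?geometric_sum_le// mulr_ge0 ?(ltW sd0)// mulr_ge0// exprn_ge0//.
rewrite -sqrt_exp_powR -/q.
have -> : 72 * (p / Num.sqrt d%:R * q ^+ pd d) = 24 * p / Num.sqrt d%:R * (3 * q ^+ pd d) by ring.
rewrite ler_wpM2r ?mulr_ge0 ?exprn_ge0 ?sqrtr_ge0// ler_wpM2r ?(ltW sd0)// ler_wpM2l//.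
rewrite -tp; apply: lerXn2r; rewrite ?nnegrE//; first lra.
by rewrite ge_min lexx orbT.
Qed.

Lemma rel_radius_le (q : R) : (forall q, 0 < q -> 0 < r q d) -> 0 < q ->
  rel_radius r d * crit_radius q d <= r q d.
Proof.
move=> r0 q0; rewrite -ler_pdivlMr ?crit_radius_gt0//.
apply: ge_inf; last by exists q => //=; rewrite in_itv/= q0.
exists 0 => _ /= [q' + <-]; rewrite in_itv/= andbT => q'0.
by rewrite divr_ge0 ?ltW ?r0// crit_radius_gt0.
Qed.

(** The splitting level is [L = rho^(1/(2m))]: it diverges, so [1 / L^2] vanishes, while
    [L^(2m-2) <= rho] stays small against [A >= rho^2]. *)
Lemma max_test_power_ge (p : R) (m : nat) (th : 'rV[R]_d) : (forall q, 0 < q -> 0 < r q d) ->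
  (1 < m)%N -> (2 * m <= pd d)%N -> p <= (2 * m)%:R ->
  1 <= rel_radius r d -> 2 * Num.sqrt (gauss_var (2 * m)) <= rel_radius r d ->
  union_alternative r p th ->
  ((1 - 4 * power_var_cst (2 * m).-1 * (2 * (rel_radius r d)^-1 +
      ((rel_radius r d `^ ((2 * m)%:R^-1)) ^+ 2)^-1))%:E <=
   P (reject_event eps pd (rel_radius r d) th))%E.
Proof.
move=> r0 m2 mp pm rho1 rho2 [q] /=; rewrite in_itv/= => /andP[q0 qp].
rewrite /lq_alternative /= => thq.
set rho := rel_radius r d in rho1 rho2 *.
set L := rho `^ _.
have m0 : (0 < 2 * m)%N by lia.
have L2m : L ^+ (2 * m) = rho.
  by rewrite -powR_mulrn ?powR_ge0// -powRrM mulVf ?pnatr_eq0 -?lt0n// powRr1// ltW.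
have L0 : 0 < L by rewrite powR_gt0.
have L1 : 1 <= L by rewrite -(powRr0 rho); apply: ler_powR; rewrite ?invr_ge0 ?ler0n.
set A := \sum_(i < d) (th ord0 i ^+ 2 + th ord0 i ^+ (2 * m)).
have HA : rho ^+ 2 * Num.sqrt d%:R <= A.
  apply: (alternative_energy d0 q0 (le_trans qp pm) rho1).
  exact: le_trans (rel_radius_le r0 q0) thq.
have sd1 : 1 <= Num.sqrt d%:R :> R by rewrite -[leLHS]sqrtr1 ler_sqrt ?ltr0n ?ler1n.
have sd2 : Num.sqrt d%:R ^+ 2 = d%:R :> R by rewrite sqr_sqrtr// ler0n.
have A2 : rho ^+ 2 <= A by apply: le_trans HA; rewrite ler_peMr ?sqr_ge0.
have A0 : 0 < A by apply: lt_le_trans A2; rewrite exprn_gt0.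
(* One of the two factors [rho] in the energy bound pays for the standard deviation. *)
have rA : 2 * (rho * Num.sqrt (d%:R * gauss_var (2 * m))) <= A.
  apply: le_trans HA; rewrite sqrtrM ?ler0n// expr2.
  rewrite (_ : 2 * _ = rho * (2 * Num.sqrt (gauss_var (2 * m))) * Num.sqrt d%:R); last by ring.
  by rewrite ler_wpM2r ?sqrtr_ge0// ler_wpM2l// ltW.
have H := power_sum_lower heps m2 L0 A0 rA.
have mE := measurable_power_event eps rho th (2 * m).
apply: (@le_trans _ _ (P (power_event eps rho th (2 * m)))); last first.
  rewrite le_measure ?inE//; first exact: measurable_reject_event.
  by move=> w Hw; exists (2 * m)%N => //=; rewrite m0.
rewrite -[power_event _ _ _ _]setCK probability_setC; last exact: measurableC.
have -> : ~` power_event eps rho th (2 * m) =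
   [set w | \sum_(i < d) `|th ord0 i + eps i w| ^+ (2 * m) <
     rho * Num.sqrt (d%:R * gauss_var (2 * m)) + d%:R * gauss_absmom (2 * m)].
  by apply/seteqP; split => w /=; rewrite /power_event/threshold/= ltNge => /negP.
rewrite EFinB; apply: leeB => //; apply: (le_trans H); rewrite lee_fin.
apply: ler_wpM2l; first exact: (mulr_ge0 (ler0n _ 4) (ltW (power_var_cst_gt0 _))).
have rV : 0 < rho^-1 by rewrite invr_gt0.
have B1 : d%:R / A ^+ 2 <= rho^-1.
  rewrite ler_pdivrMr ?exprn_gt0// -sd2.
  apply: (@le_trans _ _ (rho^-1 * (rho ^+ 2 * Num.sqrt d%:R) ^+ 2)).
    rewrite (_ : rho^-1 * _ = rho ^+ 3 * Num.sqrt d%:R ^+ 2); last by field; exact: lt0r_neq0.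
    by rewrite ler_peMl ?sqr_ge0// exprn_ege1.
  rewrite ler_wpM2l ?(ltW rV)//; apply: lerXn2r; rewrite ?nnegrE ?(ltW A0)//.
  by rewrite mulr_ge0 ?sqr_ge0 ?sqrtr_ge0.
have B2 : L ^+ (2 * m).-2 / A <= rho^-1.
  rewrite ler_pdivrMr//; apply: (@le_trans _ _ rho).
    have le2 : ((2 * m).-2 <= 2 * m)%N by clear; lia.
    by have := ler_weXn2l L1 le2; rewrite L2m.
  by rewrite ler_pdivlMl// -expr2.
lra.
Qed.

End error_bounds.

(** Over an empty alternative the infimum of the powers would be [+oo], and the error sum would not
    be bounded below by 0. *)
Lemma union_alternative_nonempty {R : realType} (r : R -> nat -> R) (p : R) (d : nat) :
  (0 < d)%N -> 0 < p -> 0 <= r p d -> exists th, union_alternative (d := d) r p th.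
Proof.
move=> d0 p0 rp; exists (const_mx (r p d)), p.
  by rewrite /= in_itv/= p0 lexx.
rewrite /lq_alternative /= lqnorm_ge//.
rewrite (bigD1 (Ordinal d0))//= mxE ger0_norm// lerDl.
by apply: sumr_ge0 => i _; exact: powR_ge0.
Qed.

Lemma error_sum_le {R : realType} (x I : \bar R) (b1 b2 : R) :
  (0 <= x)%E -> (x <= b1%:E)%E -> (I <= 1)%E -> ((1 - b2)%:E <= I)%E ->
  (0 <= x + 1 - I <= (b1 + b2)%:E)%E.
Proof.
case: x => [x| |] //; case: I => [I| |] //=.
by rewrite -!EFinD !lee_fin; lra.
Qed.

Lemma max_test_errors {disp : measure_display} {T : measurableType disp}
    {R : realType} (P : probability T R) (eps : nat -> {RV P >-> R})
    (heps : iid_std_normal eps) (r : R -> nat -> R) (pd : nat -> nat) (d : nat)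
    (p b1 b2 : R) :
  (0 < d)%N -> 0 < rel_radius r d -> 0 < p -> 0 < r p d ->
  (P (reject_event eps pd (d := d) (rel_radius r d) 0) <= b1%:E)%E ->
  (forall th, union_alternative (d := d) r p th ->
    ((1 - b2)%:E <= P (reject_event eps pd (rel_radius r d) th))%E) ->
  (0 <= 'E_P[fun w => max_test eps r pd (d := d) (noise eps d w)] + 1
     - ereal_inf [set 'E_P[fun w => max_test eps r pd (d := d) (theta + noise eps d w)%R]
                 | theta in union_alternative (d := d) r p] <= (b1 + b2)%:E)%E.
Proof.
move=> d0 rho0 p0 rp Hb1 Hb2.
have E0 : 'E_P[fun w => max_test eps r pd (d := d) (noise eps d w)]%E =
    P (reject_event eps pd (d := d) (rel_radius r d) 0).
  have -> : (fun w => max_test eps r pd (noise eps d w)) =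
      (fun w => max_test eps r pd (0 + noise eps d w)).
    by apply/funext => w; rewrite add0r.
  exact: expectation_max_test.
have [th0 Vth0] := union_alternative_nonempty d0 p0 (ltW rp).
apply: error_sum_le.
- by rewrite E0.
- by rewrite E0.
- apply: ge_ereal_inf.
  exists ('E_P[fun w => max_test eps r pd (d := d) (th0 + noise eps d w)%R])%E.
    by exists th0.
  rewrite (expectation_max_test heps pd d0 rho0).
  by apply: probability_le1; exact: measurable_reject_event.
- apply/ereal_infP => _ [th Vth <-].
  by rewrite (expectation_max_test heps pd d0 rho0); exact: Hb2.
Qed.

Unset Implicit Arguments.
Set Strict Implicit.

Theorem theoremB2 (disp : measure_display) (T : measurableType disp)
  (R : realType) (P : probability T R) (eps : nat -> {RV P >-> R})
  (heps : iid_std_normal eps)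
  (r : R -> nat -> R)
  (r_gt0 : forall (q : R) (d : nat), 0 < q -> (0 < d)%N -> 0 < r q d)
  (r_dvg : rel_radius r d @[d --> \oo] --> +oo)
  (pd : nat -> nat)
  (pd_gt0 : forall d : nat, (0 < d)%N -> (0 < pd d)%N)
  (pd_nd : forall d e : nat, (0 < d)%N -> (d <= e)%N -> (pd d <= pd e)%N)
  (pd_dvg : ((pd d)%:R : R) @[d --> \oo] --> +oo)
  (pd_tail : (pd d)%:R * std_normal_cdf (- rel_radius r d) @[d --> \oo] --> 0)
  (pd_rate : (pd d)%:R / Num.sqrt d%:R * (3 / 2 : R) `^ (3 * (pd d)%:R / 2)
               @[d --> \oo] --> 0) :
  forall p : R, 0 < p ->
    minimax_rate_consistent eps (max_test eps r pd) (union_alternative r p).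
Proof.
move=> p p0; rewrite /minimax_rate_consistent.
(* [Num.bound p] secures [p <= 2 * m], and the added 2 secures [1 < m]. *)
pose m := (Num.bound p).+2.
have pm : p <= (2 * m)%:R.
  apply: (le_trans (ltW (archi_boundP (ltW p0)))).
  by rewrite ler_nat /m; lia.
pose t d : R := (pd d)%:R `^ (3^-1).
pose L d : R := rel_radius r d `^ ((2 * m)%:R^-1).
pose b1 d : R := (1 + 3 * expR 5) * ((pd d)%:R * std_normal_cdf (- rel_radius r d)
      + 3 * (t d)^-1)
    + 72 * ((pd d)%:R / Num.sqrt d%:R * (3 / 2) `^ (3 * (pd d)%:R / 2)).
pose b2 d : R := 4 * power_var_cst (2 * m).-1 *
   (2 * (rel_radius r d)^-1 + ((L d) ^+ 2)^-1).
have t_dvg : t d @[d --> \oo] --> +oo by apply: cvg_powR_pinfty.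
have L_dvg : L d @[d --> \oo] --> +oo.
  by apply: cvg_powR_pinfty => //; rewrite invr_gt0 ltr0n.
have b10 : b1 d @[d --> \oo] --> 0.
  rewrite (_ : 0 = (1 + 3 * expR 5) * (0 + 3 * 0) + 72 * 0); last by ring.
  apply: cvgD; apply: cvgMl_tmp => //; apply: cvgD => //.
  by apply: cvgMl_tmp; exact: cvg_inv_pinfty.
have b20 : b2 d @[d --> \oo] --> 0.
  rewrite (_ : 0 = 4 * power_var_cst (2 * m).-1 * (2 * 0 + 0 * 0)); last by ring.
  apply: cvgMl_tmp; apply: cvgD; first by apply: cvgMl_tmp; exact: cvg_inv_pinfty.
  under eq_fun do rewrite expr2 invfM.
  by apply: cvgM; exact: cvg_inv_pinfty.
apply: (@squeeze_cvge _ _ _ _ (cst 0%E) _ (fun d => (b1 d + b2 d)%:E)); last 2 first.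
- exact: cvg_cst.
- apply: cvg_EFin; first exact: nearW.
  by rewrite /= -[X in _ --> X]addr0; apply: cvgD.
move/cvgryPge : r_dvg => r_dvg; move/cvgryPge : t_dvg => t_dvg.
move/cvgryPge : pd_dvg => pd_dvg.
near=> d.
have d0 : (0 < d)%N by near: d; exact: nbhs_infty_gt.
have rho3 : 3 <= rel_radius r d by near: d; exact: r_dvg.
have rho0 : 0 < rel_radius r d by lra.
have rho2 : 2 * Num.sqrt (gauss_var (2 * m)) <= rel_radius r d by near: d; exact: r_dvg.
have t3 : 3 <= t d by near: d; exact: t_dvg.
have mp : (2 * m <= pd d)%N by rewrite -(ler_nat R); near: d; exact: pd_dvg.
apply: (max_test_errors heps d0 rho0 p0 (r_gt0 _ _ p0 d0)).
  exact: max_test_size_le (pd_gt0 _ d0) rho3 t3.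
move=> th Vth; apply: max_test_power_ge Vth => //; last lra.
by move=> q q0; exact: r_gt0.
Unshelve. all: by end_near. Qed.
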